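(* Let $n\ge 2$ be an integer. Let $\mathcal{V}$ be a variety of lattices such that at least one of the following holds: $M_3\in\mathcal{V}$, $L_2\in\mathcal{V}$, $L_3\in\mathcal{V}$, $L_4\in\mathcal{V}$, $L_2^{\mathrm d}\in\mathcal{V}$, or $L_4^{\mathrm d}\in\mathcal{V}$. Then there exists a bounded lattice $L\in\mathcal{V}$ such that $L$ is congruence $(n+1)$-permutable, $\operatorname{card}L=\aleph_1$, and $L$ has no congruence $n$-permutable, congruence-preserving extension in the variety of all lattices.
   Context: An algebra $A$ is congruence $n$-permutable if for all congruences $\alpha,\beta$ of $A$, $\alpha\circ\beta\circ\alpha\circ\cdots=\beta\circ\alpha\circ\beta\circ\cdots$ ($n$ factors on each side). A lattice $B$ is a congruence-preserving extension of a lattice $A$ if $A$ is a sublattice of $B$ and every congruence of $A$ has a unique extension to a congruence of $B$ (equivalently, the inclusion induces an isomorphism from the semilattice of compact congruences of $A$ onto that of $B$). $L^{\mathrm d}$ is the dual lattice of $L$. The finite lattices are given by their covering relations ($\prec$): - $M_3=\{0,x_1,x_2,x_3,1\}$: $0\prec x_1,x_2,x_3\prec 1$. - $L_2=\{0,a,b,x_1,x_2,x_3,1\}$ (7 elements): $0\prec a$, $0\prec b$, $a\prec x_1$, $b\prec x_2$, $a\prec x_3$, $b\prec x_3$, $x_1\prec1$, $x_2\prec1$, $x_3\prec1$. - $L_3=\{0,c,d,x_1,x_2,x_3,1\}$ (7 elements): $0\prec x_1$, $0\prec c$, $x_1\prec d$, $c\prec x_2$, $x_2\prec d$, $c\prec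 x_3$, $d\prec 1$, $x_3\prec1$. - $L_4=\{0,e,x_1,x_2,x_3,1\}$ (6 elements): $0\prec x_1$, $0\prec x_2$, $0\prec x_3$, $x_1\prec e$, $x_2\prec e$, $e\prec1$, $x_3\prec 1$. *)

(* Defs.v *)
From HB Require Import structures.
From mathcomp Require Import all_boot all_order.
From mathcomp Require Import boolp classical_sets functions cardinality.

Set Implicit Arguments.
Unset Strict Implicit.
Unset Printing Implicit Defensive.

Inductive lattice_term :=
  | LVar of nat
  | LMeet of lattice_term & lattice_term
  | LJoin of lattice_term & lattice_term.

Fixpoint lattice_eval d (L : latticeType d) (v : nat -> L) (t : lattice_term)
    : L :=
  match t with
  | LVar i => v i
  | LMeet s u => Order.meet (lattice_eval v s) (lattice_eval v u)
  | LJoin s u => Order.join (lattice_eval v s) (lattice_eval v u)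
  end.

Definition lattice_models (E : set (lattice_term * lattice_term))
    d (L : latticeType d) : Prop :=
  forall s t : lattice_term, E (s, t) ->
  forall v : nat -> L, lattice_eval v s = lattice_eval v t.

Definition lattice_class := forall d : Order.disp_t, latticeType d -> Prop.

(* Equational classes of lattices, in the signature without bounds. *)
Definition lattice_variety (V : lattice_class) : Prop :=
  exists E : set (lattice_term * lattice_term),
  forall d (L : latticeType d), V d L <-> lattice_models E L.

Record congruence d (L : latticeType d) (theta : L -> L -> Prop) : Prop := {
  congruence_refl : forall x, theta x x;
  congruence_sym : forall x y, theta x y -> theta y x;
  congruence_trans : forall x y z, theta x y -> theta y z -> theta x z;
  congruence_meet : forall x x' y y', theta x x' -> theta y y' ->
    theta (Order.meet x y) (Order.meet x' y');
  congruence_join : forall x x' y y', theta x x' -> theta y y' ->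
    theta (Order.join x y) (Order.join x' y') }.

Definition rel_comp (T : Type) (r s : T -> T -> Prop) (x z : T) : Prop :=
  exists y, r x y /\ s y z.

(* r o s o r o ... with n factors; the empty composition is equality. *)
Fixpoint alt_comp (T : Type) (n : nat) (r s : T -> T -> Prop)
    : T -> T -> Prop :=
  match n with
  | 0 => fun x y => x = y
  | 1 => r
  | m.+1 => rel_comp r (alt_comp m s r)
  end.

Definition congruence_permutable (n : nat) d (L : latticeType d) : Prop :=
  forall alpha beta : L -> L -> Prop, congruence alpha -> congruence beta ->
  forall x y, alt_comp n alpha beta x y <-> alt_comp n beta alpha x y.

Definition congruence_extends dA dB (A : latticeType dA) (B : latticeType dB)
    (f : A -> B) (theta : A -> A -> Prop) (psi : B -> B -> Prop) : Prop :=
  congruence psi /\ forall x y, psi (f x) (f y) <-> theta x y.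

(* The sublattice inclusion is rendered by an injective lattice homomorphism
   f, which need not preserve bounds. *)
Definition congruence_preserving_extension dA dB
    (A : latticeType dA) (B : latticeType dB) (f : {lmorphism A -> B}) : Prop :=
  injective f /\
  forall theta : A -> A -> Prop, congruence theta ->
    (exists psi, congruence_extends f theta psi) /\
    (forall psi psi', congruence_extends f theta psi ->
       congruence_extends f theta psi' -> forall x y, psi x y <-> psi' x y).

(* aleph_1 as the least uncountable cardinal. *)
Definition card_aleph1 (T : Type) : Prop :=
  ~ countable [set: T] /\
  forall U : Type, ~ countable [set: U] -> card_le [set: T] [set: U].

(* [cov_le] is a computable version of [connect cov], following at most three
   covering steps: none of the finite lattices below has a longer chain. *)
Definition cov_le (T : eqType) (elts : seq T) (cov : rel T) (x y : T) : bool :=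
  let step (r : rel T) x y :=
    (x == y) || has (fun z => if cov x z then r z y else false) elts in
  step (step (step eq_op)) x y.

Lemma cov_leE (T : finType) (elts : seq T) (cov : rel T) :
  (forall x y z, cov x y -> cov_le elts cov y z -> cov_le elts cov x z) ->
  connect cov =2 cov_le elts cov.
Proof.
move=> covS x y; apply/idP/idP.
  case/connectP=> p; elim: p x => [|z p IHp] x /= => [_ ->|/andP[xz zp] ylast].
    by rewrite /cov_le eqxx.
  exact: covS xz (IHp _ zp ylast).
have stepP (r : rel T) : (forall x y, r x y -> connect cov x y) ->
    forall x y, (x == y) || has (fun z => if cov x z then r z y else false) elts ->
    connect cov x y.
  move=> rP {}x {}y /orP[/eqP-> //|/hasP[z _]]; case: ifP => // xz /rP.
  exact: connect_trans (connect1 xz).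
have eqP0 u v : u == v -> connect cov u v by move/eqP->.
exact: (stepP _ (stepP _ (stepP _ eqP0))).
Qed.

Fact finlat_display : Order.disp_t. Proof. exact: Order.Disp tt tt. Qed.

(* The finite lattices are given by their covering relation; the order is its
   reflexive-transitive closure. *)
Variant M3 : predArgType :=
  M3_0 | M3_x1 | M3_x2 | M3_x3 | M3_1.

Definition M3_elts := [:: M3_0; M3_x1; M3_x2; M3_x3; M3_1].
Definition M3_index x :=
  match x with
  | M3_0 => 0 | M3_x1 => 1 | M3_x2 => 2 | M3_x3 => 3 | M3_1 => 4
  end.
Fact M3_indexK : cancel M3_index (nth M3_0 M3_elts). Proof. by case. Qed.
HB.instance Definition _ := Countable.copy M3 (can_type M3_indexK).
Fact M3_enumP : Finite.axiom M3_elts. Proof. by case. Qed.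
HB.instance Definition _ := isFinite.Build M3 M3_enumP.

Definition M3_cover : rel M3 := fun x y => (x, y) \in
  [:: (M3_0, M3_x1); (M3_0, M3_x2); (M3_0, M3_x3);
      (M3_x1, M3_1); (M3_x2, M3_1); (M3_x3, M3_1)].
Definition M3_le : rel M3 := connect M3_cover.

Fact M3_leE : M3_le =2 cov_le M3_elts M3_cover.
Proof. by apply: cov_leE; do 3!case; vm_compute. Qed.
Fact M3_le_refl : reflexive M3_le. Proof. by move=> x; apply: connect0. Qed.
Fact M3_le_anti : antisymmetric M3_le.
Proof. by move=> x y; rewrite !M3_leE; case: x; case: y; vm_compute. Qed.
Fact M3_le_trans : transitive M3_le.
Proof. by move=> y x z; apply: connect_trans. Qed.
HB.instance Definition _ := Order.Le_isPOrder.Build finlat_display M3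
  M3_le_refl M3_le_anti M3_le_trans.
Definition M3_meet (x y : M3) : M3 :=
  let le := cov_le M3_elts M3_cover in
  if le x y then x else if le y x then y else M3_0.
Definition M3_join (x y : M3) : M3 :=
  let le := cov_le M3_elts M3_cover in
  if le y x then x else if le x y then y else M3_1.
Fact M3_meetP (x y z : M3) : (x <= M3_meet y z)%O =
  (x <= y)%O && (x <= z)%O.
Proof. by rewrite /Order.le /= !M3_leE; case: y; case: z; case: x; vm_compute. Qed.
Fact M3_joinP (x y z : M3) : (M3_join x y <= z)%O =
  (x <= z)%O && (y <= z)%O.
Proof. by rewrite /Order.le /= !M3_leE; case: y; case: z; case: x; vm_compute. Qed.
HB.instance Definition _ :=
  Order.POrder_MeetJoin_isLattice.Build finlat_display M3 M3_meetP M3_joinP.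

Variant L2 : predArgType :=
  L2_0 | L2_a | L2_b | L2_x1 | L2_x2 | L2_x3 | L2_1.

Definition L2_elts := [:: L2_0; L2_a; L2_b; L2_x1; L2_x2; L2_x3; L2_1].
Definition L2_index x :=
  match x with
  | L2_0 => 0 | L2_a => 1 | L2_b => 2 | L2_x1 => 3 | L2_x2 => 4
  | L2_x3 => 5 | L2_1 => 6
  end.
Fact L2_indexK : cancel L2_index (nth L2_0 L2_elts). Proof. by case. Qed.
HB.instance Definition _ := Countable.copy L2 (can_type L2_indexK).
Fact L2_enumP : Finite.axiom L2_elts. Proof. by case. Qed.
HB.instance Definition _ := isFinite.Build L2 L2_enumP.

Definition L2_cover : rel L2 := fun x y => (x, y) \in
  [:: (L2_0, L2_a); (L2_0, L2_b); (L2_a, L2_x1);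
      (L2_b, L2_x2); (L2_a, L2_x3); (L2_b, L2_x3);
      (L2_x1, L2_1); (L2_x2, L2_1); (L2_x3, L2_1)].
Definition L2_le : rel L2 := connect L2_cover.

Fact L2_leE : L2_le =2 cov_le L2_elts L2_cover.
Proof. by apply: cov_leE; do 3!case; vm_compute. Qed.
Fact L2_le_refl : reflexive L2_le. Proof. by move=> x; apply: connect0. Qed.
Fact L2_le_anti : antisymmetric L2_le.
Proof. by move=> x y; rewrite !L2_leE; case: x; case: y; vm_compute. Qed.
Fact L2_le_trans : transitive L2_le.
Proof. by move=> y x z; apply: connect_trans. Qed.
HB.instance Definition _ := Order.Le_isPOrder.Build finlat_display L2
  L2_le_refl L2_le_anti L2_le_trans.
Definition L2_meet (x y : L2) : L2 :=
  let le := cov_le L2_elts L2_cover in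
  if le x y then x else if le y x then y else
  match x, y with
  | L2_x1, L2_x3 | L2_x3, L2_x1 => L2_a
  | L2_x2, L2_x3 | L2_x3, L2_x2 => L2_b
  | _, _ => L2_0
  end.
Definition L2_join (x y : L2) : L2 :=
  let le := cov_le L2_elts L2_cover in
  if le y x then x else if le x y then y else
  match x, y with
  | L2_a, L2_b | L2_b, L2_a => L2_x3
  | _, _ => L2_1
  end.
Fact L2_meetP (x y z : L2) : (x <= L2_meet y z)%O =
  (x <= y)%O && (x <= z)%O.
Proof. by rewrite /Order.le /= !L2_leE; case: y; case: z; case: x; vm_compute. Qed.
Fact L2_joinP (x y z : L2) : (L2_join x y <= z)%O =
  (x <= z)%O && (y <= z)%O.
Proof. by rewrite /Order.le /= !L2_leE; case: y; case: z; case: x; vm_compute. Qed.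
HB.instance Definition _ :=
  Order.POrder_MeetJoin_isLattice.Build finlat_display L2 L2_meetP L2_joinP.

Variant L3 : predArgType :=
  L3_0 | L3_c | L3_d | L3_x1 | L3_x2 | L3_x3 | L3_1.

Definition L3_elts := [:: L3_0; L3_c; L3_d; L3_x1; L3_x2; L3_x3; L3_1].
Definition L3_index x :=
  match x with
  | L3_0 => 0 | L3_c => 1 | L3_d => 2 | L3_x1 => 3 | L3_x2 => 4
  | L3_x3 => 5 | L3_1 => 6
  end.
Fact L3_indexK : cancel L3_index (nth L3_0 L3_elts). Proof. by case. Qed.
HB.instance Definition _ := Countable.copy L3 (can_type L3_indexK).
Fact L3_enumP : Finite.axiom L3_elts. Proof. by case. Qed.
HB.instance Definition _ := isFinite.Build L3 L3_enumP.

Definition L3_cover : rel L3 := fun x y => (x, y) \in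
  [:: (L3_0, L3_x1); (L3_0, L3_c); (L3_x1, L3_d);
      (L3_c, L3_x2); (L3_x2, L3_d); (L3_c, L3_x3);
      (L3_d, L3_1); (L3_x3, L3_1)].
Definition L3_le : rel L3 := connect L3_cover.

Fact L3_leE : L3_le =2 cov_le L3_elts L3_cover.
Proof. by apply: cov_leE; do 3!case; vm_compute. Qed.
Fact L3_le_refl : reflexive L3_le. Proof. by move=> x; apply: connect0. Qed.
Fact L3_le_anti : antisymmetric L3_le.
Proof. by move=> x y; rewrite !L3_leE; case: x; case: y; vm_compute. Qed.
Fact L3_le_trans : transitive L3_le.
Proof. by move=> y x z; apply: connect_trans. Qed.
HB.instance Definition _ := Order.Le_isPOrder.Build finlat_display L3
  L3_le_refl L3_le_anti L3_le_trans.
Definition L3_meet (x y : L3) : L3 :=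
  let le := cov_le L3_elts L3_cover in
  if le x y then x else if le y x then y else
  match x, y with
  | L3_d, L3_x3 | L3_x3, L3_d => L3_c
  | L3_x2, L3_x3 | L3_x3, L3_x2 => L3_c
  | _, _ => L3_0
  end.
Definition L3_join (x y : L3) : L3 :=
  let le := cov_le L3_elts L3_cover in
  if le y x then x else if le x y then y else
  match x, y with
  | L3_x1, L3_c | L3_c, L3_x1 => L3_d
  | L3_x1, L3_x2 | L3_x2, L3_x1 => L3_d
  | _, _ => L3_1
  end.
Fact L3_meetP (x y z : L3) : (x <= L3_meet y z)%O =
  (x <= y)%O && (x <= z)%O.
Proof. by rewrite /Order.le /= !L3_leE; case: y; case: z; case: x; vm_compute. Qed.
Fact L3_joinP (x y z : L3) : (L3_join x y <= z)%O =
  (x <= z)%O && (y <= z)%O.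
Proof. by rewrite /Order.le /= !L3_leE; case: y; case: z; case: x; vm_compute. Qed.
HB.instance Definition _ :=
  Order.POrder_MeetJoin_isLattice.Build finlat_display L3 L3_meetP L3_joinP.

Variant L4 : predArgType :=
  L4_0 | L4_e | L4_x1 | L4_x2 | L4_x3 | L4_1.

Definition L4_elts := [:: L4_0; L4_e; L4_x1; L4_x2; L4_x3; L4_1].
Definition L4_index x :=
  match x with
  | L4_0 => 0 | L4_e => 1 | L4_x1 => 2 | L4_x2 => 3 | L4_x3 => 4
  | L4_1 => 5
  end.
Fact L4_indexK : cancel L4_index (nth L4_0 L4_elts). Proof. by case. Qed.
HB.instance Definition _ := Countable.copy L4 (can_type L4_indexK).
Fact L4_enumP : Finite.axiom L4_elts. Proof. by case. Qed.
HB.instance Definition _ := isFinite.Build L4 L4_enumP.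

Definition L4_cover : rel L4 := fun x y => (x, y) \in
  [:: (L4_0, L4_x1); (L4_0, L4_x2); (L4_0, L4_x3);
      (L4_x1, L4_e); (L4_x2, L4_e); (L4_e, L4_1);
      (L4_x3, L4_1)].
Definition L4_le : rel L4 := connect L4_cover.

Fact L4_leE : L4_le =2 cov_le L4_elts L4_cover.
Proof. by apply: cov_leE; do 3!case; vm_compute. Qed.
Fact L4_le_refl : reflexive L4_le. Proof. by move=> x; apply: connect0. Qed.
Fact L4_le_anti : antisymmetric L4_le.
Proof. by move=> x y; rewrite !L4_leE; case: x; case: y; vm_compute. Qed.
Fact L4_le_trans : transitive L4_le.
Proof. by move=> y x z; apply: connect_trans. Qed.
HB.instance Definition _ := Order.Le_isPOrder.Build finlat_display L4
  L4_le_refl L4_le_anti L4_le_trans.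
Definition L4_meet (x y : L4) : L4 :=
  let le := cov_le L4_elts L4_cover in
  if le x y then x else if le y x then y else L4_0.
Definition L4_join (x y : L4) : L4 :=
  let le := cov_le L4_elts L4_cover in
  if le y x then x else if le x y then y else
  match x, y with
  | L4_x1, L4_x2 | L4_x2, L4_x1 => L4_e
  | _, _ => L4_1
  end.
Fact L4_meetP (x y z : L4) : (x <= L4_meet y z)%O =
  (x <= y)%O && (x <= z)%O.
Proof. by rewrite /Order.le /= !L4_leE; case: y; case: z; case: x; vm_compute. Qed.
Fact L4_joinP (x y z : L4) : (L4_join x y <= z)%O =
  (x <= z)%O && (y <= z)%O.
Proof. by rewrite /Order.le /= !L4_leE; case: y; case: z; case: x; vm_compute. Qed.
HB.instance Definition _ :=
  Order.POrder_MeetJoin_isLattice.Build finlat_display L4 L4_meetP L4_joinP.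

(* Main.v *)
Require Import Defs.
From mathcomp Require Import all_boot all_order.
From mathcomp Require Import boolp classical_sets functions cardinality wochoice.
From HB Require Import structures.

Set Implicit Arguments.
Unset Strict Implicit.
Unset Printing Implicit Defensive.
Import Order.TTheory.

(* Up to duality, V contains a finite lattice K with elements x, y, z such that
   x \/ y = x \/ z = 1, y /\ z = 0 and x <> 1.  An element of L consists of a
   point of a chain with n steps and of n - 1 functions with values in K on the
   square of omega_1 plus a point at infinity; each function depends on finitely
   many rows and columns only.  At the corner at infinity, the i-th function is
   the image of the point of the chain under the map onto 0, x, 1 that keeps apart
   the steps i and i+1 only; on the two edges at infinity, it takes its values in
   the distributive sublattices generated by x, y and by x, z.  Locally, L is a
   finite product of lattices K, of such distributive lattices (all of them
   3-permutable) and of the chain, so L is (n+1)-permutable.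

   Let B be an n-permutable congruence-preserving extension of L.  A path in B
   joining the ends of the chain through the two alternating congruences, taken in
   the wrong order, must leave step i+1 of the chain before step i for some i.
   This gives w in B that, like a complement of x, is 0 on [0,x] but not on [x,1].
   On the edges, distributivity yields w <= y and w <= z.  Each of these two
   inequalities is the vanishing of a compact congruence, which involves only
   finitely many points of omega_1; hence both hold at some common interior point.
   There w <= y /\ z = 0, although w is nonzero at almost all points. *)

(** * Compositions of congruences *)

Local Open Scope order_scope.

Fixpoint steps (T : Type) (r : T -> T -> Prop) (m : nat) (x y : T) : Prop :=
  if m is m'.+1 then exists2 z, r x z & steps r m' z y else x = y.

(** The order of the two congruences along a path is forgotten here; [steps_alt_comp] restores an
    alternating order at the cost of one factor. *)
Definition either (T : Type) (r s : T -> T -> Prop) (x y : T) : Prop :=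
  r x y \/ s x y.

Lemma steps_map (T U : Type) (h : T -> U) (r : T -> T -> Prop)
    (r' : U -> U -> Prop) (m : nat) (x y : T) :
  (forall u v, r u v -> r' (h u) (h v)) ->
  steps r m x y -> steps r' m (h x) (h y).
Proof.
move=> rr'; elim: m x => [|m IHm] x /= => [->//|[z xz zy]].
by exists (h z); [exact: rr' | exact: IHm].
Qed.

Lemma steps_cat (T : Type) (r : T -> T -> Prop) (m k : nat) (x y z : T) :
  steps r m x y -> steps r k y z -> steps r (m + k) x z.
Proof.
elim: m x => [|m IHm] x /= => [->//|[t xt ty] yz].
by exists t => //; exact: IHm.
Qed.

Lemma steps_sym (T : Type) (r : T -> T -> Prop) (m : nat) (x y : T) :
  (forall u v, r u v -> r v u) -> steps r m x y -> steps r m y x.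
Proof.
move=> rS; elim: m x => [|m IHm] x /= => [->//|[t xt /IHm ty]].
have tx : steps r 1 t x by exists x => //; exact: rS.
by have := steps_cat ty tx; rewrite addn1.
Qed.

Lemma steps_weaken (T : Type) (r : T -> T -> Prop) (m k : nat) (x y : T) :
  (forall u, r u u) -> (m <= k)%N -> steps r m x y -> steps r k x y.
Proof.
move=> rR /subnK <- xy; elim: (k - m)%N => // j IHj.
by exists x.
Qed.

Lemma alt_compS (T : Type) (m : nat) (r s : T -> T -> Prop) (x y : T) :
  alt_comp m.+1 r s x y <-> exists2 z, r x z & alt_comp m s r z y.
Proof.
case: m => [|m] /=; first by split=> [xy|[z xz <-]] //; exists y.
by split=> [[z [xz zy]]|[z xz zy]]; exists z.
Qed.

Lemma alt_compP (T : Type) (m : nat) (r s : T -> T -> Prop) (x y : T) :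
  alt_comp m r s x y ->
  exists w : nat -> T, [/\ w 0 = x, w m = y &
    forall j, (j < m)%N -> (if odd j then s else r) (w j) (w j.+1)].
Proof.
elim: m r s x => [|m IHm] r s x; first by move=> /= ->; exists (fun=> y).
move=> /alt_compS[z xz /IHm[w [w0 wm wS]]].
exists (fun j => if j is j'.+1 then w j' else x); split=> // -[|j] jm.
  by rewrite w0.
by have := wS j jm; rewrite /=; case: odd.
Qed.

Lemma alt_comp_path (T : Type) (m : nat) (r s : T -> T -> Prop) (w : nat -> T) :
  (forall j, (j < m)%N -> (if odd j then s else r) (w j) (w j.+1)) ->
  alt_comp m r s (w 0) (w m).
Proof.
elim: m r s w => // m IHm r s w wS; apply/alt_compS.
exists (w 1); first exact: (wS 0).
by apply: (IHm s r (w \o succn)) => j jm; have := wS j.+1 jm; rewrite /=; case: odd.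
Qed.

Lemma alt_comp_map (T U : Type) (h : T -> U) (r s : T -> T -> Prop)
    (r' s' : U -> U -> Prop) (m : nat) (x y : T) :
  (forall u v, r u v -> r' (h u) (h v)) ->
  (forall u v, s u v -> s' (h u) (h v)) ->
  alt_comp m r s x y -> alt_comp m r' s' (h x) (h y).
Proof.
elim: m r s r' s' x => [|m IHm] r s r' s' x rr' ss'; first by move=> /= ->.
move=> /alt_compS[z xz zy]; apply/alt_compS; exists (h z); first exact: rr'.
exact: IHm zy.
Qed.

Lemma alt_comp_map2 (T : Type) (op : T -> T -> T) (r s : T -> T -> Prop)
    (m : nat) (x y x' y' : T) :
  (forall u v u' v', r u v -> r u' v' -> r (op u u') (op v v')) ->
  (forall u v u' v', s u v -> s u' v' -> s (op u u') (op v v')) ->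
  alt_comp m r s x y -> alt_comp m r s x' y' ->
  alt_comp m r s (op x x') (op y y').
Proof.
elim: m r s x x' => [|m IHm] r s x x' rop sop; first by move=> /= -> ->.
move=> /alt_compS[z xz zy] /alt_compS[z' xz' zy']; apply/alt_compS.
by exists (op z z'); [exact: rop | exact: IHm].
Qed.

Lemma alt_comp_refl (T : Type) (r s : T -> T -> Prop) (m : nat) (x : T) :
  (forall u, r u u) -> (forall u, s u u) -> alt_comp m r s x x.
Proof.
elim: m r s => [|m IHm] r s rR sR //; apply/alt_compS.
by exists x => //; exact: IHm.
Qed.

Lemma alt_comp_steps (T : Type) (r s : T -> T -> Prop) (m : nat) (x y : T) :
  alt_comp m r s x y -> steps (either r s) m x y.
Proof.
elim: m r s x => [|m IHm] r s x // /alt_compS[z xz /IHm zy].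
exists z; first by left.
by apply: (steps_map (h := id)) zy => u v []; [right | left].
Qed.

(* A word in two letters with [k] letters embeds, up to repetitions, in each of
   the two alternating words with [k.+1] letters. *)
Lemma steps_alt_comp (T : Type) (r s : T -> T -> Prop) (k : nat) (x y : T) :
  (forall u, r u u) -> (forall u, s u u) ->
  (forall u v w, r u v -> r v w -> r u w) ->
  (forall u v w, s u v -> s v w -> s u w) ->
  steps (either r s) k x y -> alt_comp k.+1 r s x y.
Proof.
elim: k r s x => [|k IHk] r s x rR sR rT sT.
  by move=> /= ->; exact: rR.
case=> z xz zy.
have zy' : steps (either s r) k z y.
  by apply: (steps_map (h := id)) zy => u v []; [right | left].
have /(IHk _ _ _ sR rR sT rT) szy := zy'.
case: xz => xz; apply/alt_compS; first by exists z.
exists x => //; move: szy => /alt_compS[t zt ty].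
by apply/alt_compS; exists t => //; exact: sT zt.
Qed.

Section Congruences.
Context {d : Order.disp_t} {L : latticeType d}.
Implicit Types (alpha beta theta : L -> L -> Prop).

Lemma congruence_inter (I : Type) (P : I -> Prop) (Theta : I -> L -> L -> Prop) :
  (forall i, P i -> congruence (Theta i)) ->
  congruence (fun x y => forall i, P i -> Theta i x y).
Proof.
move=> cT; split.
- by move=> x i Pi; apply: congruence_refl; exact: cT.
- by move=> x y xy i Pi; apply: congruence_sym (xy i Pi); exact: cT.
- by move=> x y z xy yz i Pi; apply: congruence_trans (xy i Pi) (yz i Pi); exact: cT.
- move=> x x' y y' xx' yy' i Pi.
  by apply: congruence_meet (xx' i Pi) (yy' i Pi); exact: cT.
- move=> x x' y y' xx' yy' i Pi.
  by apply: congruence_join (xx' i Pi) (yy' i Pi); exact: cT.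
Qed.

Lemma congruence_comap d' (P : latticeType d') (e : P -> L) theta :
  {morph e : x y / x `&` y} -> {morph e : x y / x `|` y} ->
  congruence theta -> congruence (fun x y => theta (e x) (e y)).
Proof.
move=> eI eU [tR tS tT tI tU]; split=> //.
- by move=> x y; exact: tS.
- by move=> x y z; exact: tT.
- by move=> x x' y y' xx' yy'; rewrite !eI; exact: tI.
- by move=> x x' y y' xx' yy'; rewrite !eU; exact: tU.
Qed.

Lemma congruence_eq : congruence (@eq L).
Proof. by split=> // [x y z -> //|x x' y y' -> ->|x x' y y' -> ->]. Qed.

Definition cg_gen (G : L -> L -> Prop) (x y : L) : Prop :=
  forall theta, congruence theta /\ (forall a b, G a b -> theta a b) ->
  theta x y.

Lemma cg_gen_congruence G : congruence (cg_gen G).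
Proof. by apply: congruence_inter => theta []. Qed.

Lemma congruence_meetl theta x y z :
  congruence theta -> theta x y -> theta (x `&` z) (y `&` z).
Proof. by move=> ct xy; apply: congruence_meet => //; exact: congruence_refl. Qed.

Lemma congruence_joinl theta x y z :
  congruence theta -> theta x y -> theta (x `|` z) (y `|` z).
Proof. by move=> ct xy; apply: congruence_join => //; exact: congruence_refl. Qed.

(** A unary polynomial, so it respects every congruence; for [p <= q] it maps the lattice onto the
    interval from [p] to [q] and fixes that interval pointwise. *)
Definition clamp (p q w : L) := (w `|` p) `&` q.

Lemma congruence_clamp theta p q u v :
  congruence theta -> theta u v -> theta (clamp p q u) (clamp p q v).
Proof. by move=> ct uv; apply: congruence_meetl => //; exact: congruence_joinl. Qed.

Lemma clampl p q w : w <= p -> p <= q -> clamp p q w = p.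
Proof. by move=> /join_r wp /meet_l pq; rewrite /clamp wp. Qed.

Lemma clampr p q w : q <= w -> clamp p q w = q.
Proof. by move=> qw; apply: meet_r; apply: le_trans qw (leUl _ _). Qed.

Definition joined alpha beta x y := exists m, steps (either alpha beta) m x y.

Lemma joined_clamp alpha beta p q u v :
  congruence alpha -> congruence beta -> u <= p -> p <= q -> q <= v ->
  joined alpha beta u v -> joined alpha beta p q.
Proof.
move=> ca cb up pq qv [m uv]; exists m.
rewrite -[X in steps _ _ X _](clampl up pq) -[X in steps _ _ _ X](clampr p qv).
by apply: steps_map uv => s t [] st; [left | right]; exact: congruence_clamp.
Qed.

(** As [clamp p q] fixes the interval pointwise, this says that the interval has no points but [p]
    and [q]; the case [p = q] is allowed. *)
Definition covers (p q : L) := p <= q /\ forall w, clamp p q w \in [:: p; q].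

(** Clamping a path from [u] to [v] leaves only the values [p] and [q]; a step at which the value
    passes from [p] to [q] lies in one of the two congruences. *)
Lemma covers_joined alpha beta p q u v :
  congruence alpha -> congruence beta -> u <= p -> q <= v -> covers p q ->
  joined alpha beta u v -> either alpha beta p q.
Proof.
move=> ca cb up qv [pq cov] uv.
have [m {uv}] := joined_clamp ca cb up pq qv uv.
suff main x y : clamp p q x = p -> clamp p q y = q ->
    steps (either alpha beta) m x y -> either alpha beta p q.
  by apply: main; [exact: clampl | exact: clampr].
elim: m x => [|m IHm] x hx hy /= => [xy|[z xz zy]].
  by left; rewrite -hx -[X in alpha _ X]hy xy; exact: congruence_refl.
have := cov z; rewrite !inE => /orP[] /eqP hz; first exact: IHm hz hy zy.
rewrite -[X in either _ _ X]hx -[X in either _ _ _ X]hz.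
by case: xz; [left | right]; exact: congruence_clamp.
Qed.

Definition steppable (k : nat) := forall alpha beta,
  congruence alpha -> congruence beta ->
  forall u v, u <= v -> joined alpha beta u v ->
  steps (either alpha beta) k u v.

Lemma steppable_weaken (k m : nat) : (k <= m)%N -> steppable k -> steppable m.
Proof.
move=> km kP alpha beta ca cb u v uv /(kP _ _ ca cb _ _ uv).
by apply: steps_weaken => // w; left; exact: congruence_refl.
Qed.

(** Two alternating paths of the same shape lead from [x] down to the meet and from the meet up to
    [y]; by absorption, their termwise join leads from [x] to [y]. *)
Lemma steppable_alt_comp (k : nat) alpha beta x y :
  steppable k -> congruence alpha -> congruence beta ->
  joined alpha beta x y -> alt_comp k.+1 alpha beta x y.
Proof.
move=> kP ca cb xy.
have stepsI u z : z <= u -> joined alpha beta z u ->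
    alt_comp k.+1 alpha beta z u /\ alt_comp k.+1 alpha beta u z.
  move=> zu /(kP _ _ ca cb _ _ zu) zus; have [? ? ? _ _] := ca.
  have [? ? ? _ _] := cb; split; apply: steps_alt_comp => //.
  by apply: steps_sym zus => s t [] ?; [left | right]; auto.
have meet_steps w u v m : steps (either alpha beta) m u v ->
    steps (either alpha beta) m (u `&` w) (v `&` w).
  apply: (steps_map (h := fun u => u `&` w)) => s t.
  by case=> st; [left | right]; exact: congruence_meetl.
have [m xym] := xy.
have [|_ dn] := stepsI x (x `&` y) (leIl _ _).
  exists m; apply: steps_sym.
    by move=> s t [] ?; [left | right]; exact: congruence_sym.
  by have := meet_steps x _ _ _ xym; rewrite meetxx [y `&` x]meetC.
have [|up _] := stepsI y (x `&` y) (leIr _ _).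
  by exists m; have := meet_steps y _ _ _ xym; rewrite meetxx.
have := alt_comp_map2 (op := @Order.join _ _) (congruence_join ca)
  (congruence_join cb) dn up.
by rewrite meetKU meetUK.
Qed.

End Congruences.

(** * Short paths in finite lattices *)

(** Comparison is expressed by a meet: the meets of the concrete lattices evaluate well, whereas an
    order defined through [connect] does not. *)
Definition coverb d (P : latticeType d) (elts : seq P) (p q : P) : bool :=
  (p `&` q == p) && all (fun w => clamp p q w \in [:: p; q]) elts.

Definition two_coversb d (P : latticeType d) (elts : seq P) (u v : P) : bool :=
  has (fun w => coverb elts u w && coverb elts w v) elts.

Section FiniteLattice.
Context {d : Order.disp_t} {P : latticeType d} (elts : seq P).
Hypothesis eltsP : forall w, w \in elts.

Lemma coverP (p q : P) : coverb elts p q -> covers p q.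
Proof.
case/andP=> pq /allP cov; split; first by rewrite leEmeet.
by move=> w; exact: cov.
Qed.

Lemma two_coversP (alpha beta : P -> P -> Prop) (u v : P) :
  congruence alpha -> congruence beta -> two_coversb elts u v ->
  joined alpha beta u v -> steps (either alpha beta) 2 u v.
Proof.
move=> ca cb /hasP[w _ /andP[/coverP uw /coverP wv]] uv.
exists w; first by apply: covers_joined uw uv => //; case: wv.
by exists v => //; apply: covers_joined wv uv => //; case: uw.
Qed.
End FiniteLattice.

Lemma M3_steppable : steppable (L := M3) 2.
Proof.
have eltsP w : w \in M3_elts by case: w.
move=> alpha beta ca cb u v uv; apply: (two_coversP eltsP ca cb).
by move: uv; rewrite leEmeet; case: u; case: v; vm_compute.
Qed.

Lemma L4_steppable : steppable (L := L4) 2.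
Proof.
have eltsP w : w \in L4_elts by case: w.
move=> alpha beta ca cb u v uv; apply: (two_coversP eltsP ca cb).
by move: uv; rewrite leEmeet; case: u; case: v; vm_compute.
Qed.
Lemma L2_steppable : steppable (L := L2) 2.
Proof.
have eltsP w : w \in L2_elts by case: w.
move=> alpha beta ca cb u v uv.
have : two_coversb L2_elts u v || ((u, v) == (L2_0, L2_1)).
  by move: uv; rewrite leEmeet; case: u; case: v; vm_compute.
case/orP=> [/(two_coversP eltsP ca cb) //|/eqP[-> ->]] j01.
have cov0a : covers L2_0 L2_a by apply: (coverP eltsP); vm_compute.
have covx1 : covers L2_x1 L2_1 by apply: (coverP eltsP); vm_compute.
(* Joining with [L2_x2] and then meeting with [L2_x1] sends [L2_0], [L2_a] to [L2_0], [L2_x1], so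
   two steps through [L2_x1] suffice. *)
have up theta : congruence theta -> theta L2_0 L2_a -> theta L2_0 L2_x1.
  by move=> ct /(congruence_clamp L2_x2 L2_x1 ct).
have le0 (w : L2) : L2_0 <= w by rewrite leEmeet; case: w.
have le1 (w : L2) : w <= L2_1 by rewrite leEmeet; case: w.
exists L2_x1.
  by case: (covers_joined ca cb (le0 _) (le1 _) cov0a j01); [left | right];
    exact: up.
by exists L2_1 => //; exact: covers_joined covx1 j01.
Qed.

Lemma L3_steppable : steppable (L := L3) 2.
Proof.
have eltsP w : w \in L3_elts by case: w.
move=> alpha beta ca cb u v uv.
have : two_coversb L3_elts u v || ((u, v) == (L3_0, L3_1)).
  by move: uv; rewrite leEmeet; case: u; case: v; vm_compute.
case/orP=> [/(two_coversP eltsP ca cb) //|/eqP[-> ->]] j01.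
have covx1 : covers L3_x1 L3_d by apply: (coverP eltsP); vm_compute.
have covd : covers L3_d L3_1 by apply: (coverP eltsP); vm_compute.
(* Collapsing [L3_x1] with [L3_d] collapses [L3_0] with [L3_x2], and then, by joining with [L3_x3]
   and meeting with [L3_x1], also [L3_0] with [L3_x1]. *)
have down theta : congruence theta -> theta L3_x1 L3_d -> theta L3_0 L3_d.
  move=> ct x1d; apply: congruence_trans (x1d) => //.
  have : theta L3_0 L3_x2 by have := congruence_clamp L3_0 L3_x2 ct x1d.
  by move/(congruence_clamp L3_x3 L3_x1 ct).
have le0 (w : L3) : L3_0 <= w by rewrite leEmeet; case: w.
have le1 (w : L3) : w <= L3_1 by rewrite leEmeet; case: w.
exists L3_d.
  by case: (covers_joined ca cb (le0 _) (le1 _) covx1 j01); [left | right];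
    exact: down.
by exists L3_1 => //; exact: covers_joined covd j01.
Qed.

(** The four-element Boolean lattice with a new bottom. Short paths are found in this abstract
    lattice and carried over by homomorphisms that may identify some of its points. *)
Variant D5 : predArgType := D5_0 | D5_a | D5_x | D5_y | D5_1.

Definition D5_elts := [:: D5_0; D5_a; D5_x; D5_y; D5_1].
Definition D5_index z :=
  match z with D5_0 => 0 | D5_a => 1 | D5_x => 2 | D5_y => 3 | D5_1 => 4 end.
Fact D5_indexK : cancel D5_index (nth D5_0 D5_elts). Proof. by case. Qed.
HB.instance Definition _ := Countable.copy D5 (can_type D5_indexK).

Definition D5_meet (u v : D5) : D5 :=
  match u, v with
  | D5_0, _ | _, D5_0 => D5_0
  | D5_1, w | w, D5_1 => w
  | D5_x, D5_x => D5_x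
  | D5_y, D5_y => D5_y
  | _, _ => D5_a
  end.
Definition D5_join (u v : D5) : D5 :=
  match u, v with
  | D5_0, w | w, D5_0 => w
  | D5_1, _ | _, D5_1 => D5_1
  | D5_a, w | w, D5_a => w
  | D5_x, D5_x => D5_x
  | D5_y, D5_y => D5_y
  | _, _ => D5_1
  end.
Definition D5_le (u v : D5) : bool := D5_meet u v == u.

Fact D5_le_refl : reflexive D5_le. Proof. by case. Qed.
Fact D5_le_anti : antisymmetric D5_le. Proof. by case; case. Qed.
Fact D5_le_trans : transitive D5_le. Proof. by case; case; case. Qed.
HB.instance Definition _ := Order.Le_isPOrder.Build finlat_display D5
  D5_le_refl D5_le_anti D5_le_trans.
Fact D5_meetP (u v w : D5) : (u <= D5_meet v w) = (u <= v) && (u <= w).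
Proof. by case: u; case: v; case: w. Qed.
Fact D5_joinP (u v w : D5) : (D5_join u v <= w) = (u <= w) && (v <= w).
Proof. by case: u; case: v; case: w. Qed.
HB.instance Definition _ :=
  Order.POrder_MeetJoin_isLattice.Build finlat_display D5 D5_meetP D5_joinP.

(* Two of the three intervals [0,a], [a,x], [a,y] lie in the same one of the two
   congruences, which tells through which of a, x, y to go from 0 to 1. *)
Lemma D5_steppable : steppable (L := D5) 2.
Proof.
have eltsP w : w \in D5_elts by case: w.
move=> alpha beta ca cb u v uv.
have : two_coversb D5_elts u v || ((u, v) == (D5_0, D5_1)).
  by move: uv; rewrite leEmeet; case: u; case: v; vm_compute.
case/orP=> [/(two_coversP eltsP ca cb) //|/eqP[-> ->]] j01.
have cov0a : covers D5_0 D5_a by apply: (coverP eltsP); vm_compute.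
have covax : covers D5_a D5_x by apply: (coverP eltsP); vm_compute.
have covay : covers D5_a D5_y by apply: (coverP eltsP); vm_compute.
have xy1 theta : congruence theta -> theta D5_a D5_x -> theta D5_y D5_1.
  by move=> ct /(congruence_clamp D5_y D5_1 ct).
have yx1 theta : congruence theta -> theta D5_a D5_y -> theta D5_x D5_1.
  by move=> ct /(congruence_clamp D5_x D5_1 ct).
have le0 (w : D5) : D5_0 <= w by case: w.
have le1 (w : D5) : w <= D5_1 by case: w.
have h0a := covers_joined ca cb (le0 _) (le1 _) cov0a j01.
have hax := covers_joined ca cb (le0 _) (le1 _) covax j01.
have hay := covers_joined ca cb (le0 _) (le1 _) covay j01.
have via w : either alpha beta D5_0 w -> either alpha beta w D5_1 ->
    steps (either alpha beta) 2 D5_0 D5_1.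
  by move=> h0 h1; exists w => //; exists D5_1.
have tA := congruence_trans ca; have tB := congruence_trans cb.
case: (h0a) => a0; case: (hax) => ax; case: (hay) => ay.
- by apply: (via D5_x); left; [exact: tA a0 ax | exact: yx1].
- by apply: (via D5_x); [left; exact: tA a0 ax | right; exact: yx1].
- by apply: (via D5_y); [left; exact: tA a0 ay | right; exact: xy1].
- by apply: (via D5_a) => //; right; apply: tB ax _; exact: yx1.
- by apply: (via D5_a) => //; left; apply: tA ax _; exact: yx1.
- by apply: (via D5_y); [right; exact: tB a0 ay | left; exact: xy1].
- by apply: (via D5_x); [right; exact: tB a0 ax | left; exact: yx1].
- by apply: (via D5_x); right; [exact: tB a0 ax | exact: yx1].
Qed.

Lemma D5_meetUr (u v w : D5) : u `&` (v `|` w) = (u `&` v) `|` (u `&` w).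
Proof. by case: u; case: v; case: w. Qed.

(** Consecutive points form covers, so the path can climb one point at a time; shorter paths are
    padded. *)
Lemma ord_steppable (n : nat) : steppable (L := 'I_n.+1) n.
Proof.
move=> alpha beta ca cb u v uv j.
have main k (p : 'I_n.+1) : (p + k)%N = v -> u <= p ->
    steps (either alpha beta) k p v.
  elim: k p => [|k IHk] p; first by rewrite addn0 => pv _; exact: val_inj.
  move=> pv up.
  have ltp : (p.+1 < n.+1)%N.
    by apply: leq_trans (ltn_ord v); rewrite ltnS -pv addnS ltnS leq_addr.
  exists (Ordinal ltp).
    apply: covers_joined j => //.
      by rewrite leEord /= -pv addnS ltnS leq_addr.
    split; first by rewrite leEord /=.
    move=> w; rewrite !inE; have [wp|pw] := leP w p.
      by rewrite clampl ?eqxx // leEord /=.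
    by rewrite clampr ?eqxx ?orbT // leEord /=.
  apply: IHk; first by rewrite /= addSnnS.
  by rewrite leEord /= ltnW.
have := main (v - u)%N u _ (lexx _); rewrite (subnKC (uv : (u <= v)%N)).
move=> /(_ erefl); apply: steps_weaken.
  by move=> w; left; exact: congruence_refl.
by apply: leq_trans (leq_subr _ _) _; rewrite -ltnS.
Qed.

(** * The first uncountable ordinal *)

Section Omega1.
Local Open Scope classical_set_scope.
Local Open Scope card_scope.

Lemma countable_inj (T U : Type) (f : T -> U) :
  injective f -> countable [set: U] -> countable [set: T].
Proof.
move=> finj /countable_injP[g ginj]; apply/countable_injP.
exists (g \o f) => x y _ _ /= gf; apply: finj; apply: ginj gf; exact: in_setT.
Qed.

Lemma uncountable_cantor : ~ countable [set: nat -> bool].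
Proof.
move=> /countable_injP[g ginj].
pose D (k : nat) : bool := `[< exists h : nat -> bool, g h = k /\ ~~ h k >].
have [Dk|Dk] := boolP (D (g D)).
  have /asboolP[h [gh hk]] := Dk.
  suff hD : h = D by rewrite hD Dk in hk.
  by apply: ginj gh; exact: in_setT.
by case/negP: (Dk); apply/asboolP; exists D.
Qed.

(** Well-orders of type at most omega_1. Uncountability is a separate hypothesis, so the natural
    numbers qualify too, as [free_pair] uses. *)
Record omega1_order (W : Type) (lt : W -> W -> Prop) : Prop := {
  omega1_wf : well_founded lt;
  omega1_total : forall a b, [\/ lt a b, a = b | lt b a];
  omega1_segment : forall a, countable [set b | lt b a] }.

(* The points of a well-ordered uncountable set that have only countably many
   predecessors. *)
Lemma exists_omega1 : exists (W : choiceType) (lt : W -> W -> Prop),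
  omega1_order lt /\ ~ countable [set: W].
Proof.
have [R Rwo] := well_ordering_principle {classic nat -> bool}.
pose T := {classic nat -> bool}.
have Rmin (A : {pred T}) a : a \in A -> exists2 z, z \in A & {in A, forall x, R z x}.
  by move=> Aa; have [|z [[Az lbz] _]] := Rwo A; [exists a | exists z].
have Rtot (a b : T) : R a b || R b a.
  have [|z] := Rmin [pred z | (z == a) || (z == b)] a; rewrite ?inE ?eqxx //.
  move=> /orP[] /eqP -> h; apply/orP; [left | right]; apply: h.
    by rewrite inE eqxx orbT.
  by rewrite inE eqxx.
have Ranti (a b : T) : R a b -> R b a -> a = b.
  move=> ab ba; have [|z [_ zu]] := Rwo [pred z | (z == a) || (z == b)].
    by exists a; rewrite inE eqxx.
  have Raa c : R c c by have := Rtot c c; rewrite orbb.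
  have minA c : (c == a) || (c == b) -> R c a -> R c b -> z = c.
    move=> Ac ca cb; apply: zu; split; first by rewrite inE.
    by move=> e; rewrite inE => /orP[] /eqP ->.
  transitivity z; first by apply/esym/minA; rewrite ?eqxx.
  by apply: minA; rewrite ?eqxx ?orbT.
pose lt (a b : T) := R a b /\ a <> b.
have ltwf : well_founded lt.
  move=> a; apply: contrapT => na.
  have [|z] := Rmin [pred z | `[< ~ Acc lt z >]] a; first exact/asboolP.
  rewrite inE => nz zmin; apply: nz; split=> b [bz bnz].
  apply: contrapT => nb; apply: bnz; apply: Ranti => //.
  by apply: zmin; apply/asboolP.
pose G (a : T) := `[< countable [set b | lt b a] >].
exists {a : T | G a}, (fun a b => lt (val a) (val b)); split.
  split.
  - move=> [a Ga]; elim: (ltwf a) Ga => {}a _ IHa Ga; split=> -[b Gb] /=.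
    by move=> /IHa; exact.
  - move=> a b; have [/val_inj ->|/eqP ab] := eqVneq (val a) (val b).
      by constructor 2.
    have /orP[Rab|Rba] := Rtot (val a) (val b); first by constructor 1.
    by constructor 3; split => // /esym.
  - move=> a; have /asboolP/countable_injP[g ginj] := valP a.
    apply/countable_injP; exists (g \o val) => b c.
    rewrite !inE => /= ba ca gbc; apply: val_inj; apply: ginj gbc; exact/mem_set.
move=> /countable_injP[g ginj].
have Gcount : countable [set a | G a].
  pose h a := if insub a is Some b then g b else 0.
  apply/countable_injP; exists h => a b; rewrite !inE /= => Ga Gb.
  rewrite /h (insubT G Ga) (insubT G Gb) => /ginj.
  by rewrite !in_setT => /(_ isT isT) [].
(* If [G] holds everywhere, Cantor's theorem is contradicted. Otherwise all predecessors of the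
   least point outside [G] satisfy [G]; they are countably many, so this point satisfies [G] as
   well. *)
have [GT|] := pselect (forall a, G a).
  apply: uncountable_cantor; apply: sub_countable Gcount; apply: subset_card_le.
  by move=> a _; exact: GT.
move=> /existsNP[a Ga].
have [|z] := Rmin [pred z | ~~ G z] a; first exact/negP.
rewrite inE => nz zmin; case/negP: nz; apply/asboolP.
apply: sub_countable Gcount; apply: subset_card_le => b [Rbz bz] /=.
by apply: contrapT => /negP nGb; apply: bz; apply: Ranti => //; exact: zmin.
Qed.

(** Transfinite recursion: the value at [w] is chosen outside the values at the predecessors of [w],
    of which there are only countably many. *)
Lemma omega1_inject (W : Type) (lt : W -> W -> Prop) (U : Type) :
  omega1_order lt -> ~ countable [set: U] -> exists g : W -> U, injective g.
Proof.
move=> [ltwf lttot ltseg] Uunc.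
have fresh w (rec : forall w', lt w' w -> U) :
    exists u, forall w' (h : lt w' w), rec w' h <> u.
  apply: contrapT => /forallNP nex; apply: Uunc.
  have {}nex u : exists w', exists h : lt w' w, rec w' h = u.
    have /existsNP[w' /existsNP[h /contrapT hu]] := nex u.
    by exists w', h.
  have [k kP] := choice nex.
  have kinj : injective k.
    move=> u v kuv; have [h1 e1] := kP u; have := kP v; rewrite -kuv => -[h2 e2].
    by rewrite -e1 -e2; congr rec.
  have /countable_injP[c cinj] := ltseg w.
  apply/countable_injP; exists (c \o k) => u v _ _ /= ckuv; apply: kinj.
  by apply: cinj ckuv; apply/mem_set => /=; [have [] := kP u | have [] := kP v].
pose F w rec := sval (cid (@fresh w rec)).
pose g := Fix ltwf (fun=> U) F.
have gE w : g w = F w (fun w' _ => g w').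
  apply: (Fix_eq ltwf (fun=> U) F) => x f f' ff'; congr F.
  by apply: functional_extensionality_dep => y; apply: funext => h; exact: ff'.
have glt a b : lt a b -> g a <> g b.
  by move=> ab; rewrite [g b]gE /F; case: cid => u /= uP; exact: uP.
exists g => a b gab; have [ab|//|ba] := lttot a b.
  by case: (glt _ _ ab).
by case: (glt _ _ ba).
Qed.

Lemma omega1_initial_countable (W : Type) (lt : W -> W -> Prop) (a : W) :
  omega1_order lt -> countable ([set b | lt b a] `|` [set a]).
Proof.
move=> [_ _ ltseg]; rewrite -bigcup2E.
apply: bigcup_countable; first exact: countableP.
by move=> [|[|i]] _ //=.
Qed.

Lemma omega1_bound (W : eqType) (lt : W -> W -> Prop) (S : seq W) :
  omega1_order lt -> ~ countable [set: W] -> exists a, forall s, s \in S -> lt s a.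
Proof.
move=> ltW Wunc; apply: contrapT => /forallNP nex; apply: Wunc.
have : countable (\bigcup_(s in [set s | s \in S]) ([set b | lt b s] `|` [set s])).
  apply: bigcup_countable; first by apply: finite_set_countable; exact: finite_seq.
  by move=> s _; exact: omega1_initial_countable.
apply: sub_countable; apply: subset_card_le => a _.
have /existsNP[s /not_implyP[sS nsa]] := nex a; exists s => //.
by have [//|->|] := omega1_total ltW s a; [right | left].
Qed.

(** Ordered lexicographically, [W * nat] again has type at most omega_1, so a code may consist of a
    point of [W] and a natural number. *)
Definition lexi (W : Type) (lt : W -> W -> Prop) (p q : W * nat) : Prop :=
  lt p.1 q.1 \/ p.1 = q.1 /\ (p.2 < q.2)%N.

Lemma lexi_omega1 (W : Type) (lt : W -> W -> Prop) :
  omega1_order lt -> omega1_order (lexi lt).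
Proof.
move=> ltW; have [ltwf lttot _] := ltW; split.
- move=> [a k]; elim: (ltwf a) k => {}a _ IHa k.
  elim/ltn_ind: k => k IHk; split=> -[b m] [/= ba|/= [-> mk]]; first exact: IHa.
  exact: IHk.
- move=> [a k] [b m]; have [ab|<-|ba] := lttot a b.
  + by constructor 1; left.
  + have [km|mk|->] := ltngtP k m.
    * by constructor 1; right.
    * by constructor 3; right.
    * by constructor 2.
  + by constructor 3; left.
- move=> [a k].
  have : countable (([set b | lt b a] `|` [set a]) `*` [set: nat]).
    by apply: countableX; [exact: omega1_initial_countable | exact: countableP].
  apply: sub_countable; apply: subset_card_le => -[b m] [/= ba|/= [-> _]].
    by split=> //; left.
  by split=> //; right.
Qed.

Lemma omega1_card_le (W : Type) (lt : W -> W -> Prop) (T : Type)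
    (h : T -> W * nat) (U : Type) :
  omega1_order lt -> injective h -> ~ countable [set: U] ->
  [set: T] #<= [set: U].
Proof.
move=> /lexi_omega1 ltW hinj /(omega1_inject ltW)[g ginj].
have ghinj : {in [set: T] &, injective (g \o h)}.
  by move=> a b _ _ /= /ginj /hinj.
rewrite -(card_le_eql (inj_card_eq ghinj)); exact: subset_card_le.
Qed.

(* For countably many xi the sets [F xi] cover only countably many points, so
   some eta avoids them all, and [G eta] misses one of these xi. *)
Lemma free_pair (W : choiceType) (S : seq W) (F G : W -> seq W) :
  ~ countable [set: W] ->
  exists xi eta, [/\ xi \notin S, eta \notin S, eta \notin F xi & xi \notin G eta].
Proof.
move=> Wunc.
have nat_order : omega1_order (fun a b : nat => (a < b)%N).
  split=> [k|a b|a]; last exact: countableP.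
  - by elim/ltn_ind: k => k IHk; split.
  - by case: (ltngtP a b) => ?; [constructor 1 | constructor 3 | constructor 2].
have [e einj] := omega1_inject nat_order Wunc.
have [eta etaP] : exists eta, forall k, eta \notin S ++ F (e k).
  apply: contrapT => /forallNP nex; apply: Wunc.
  have : countable (\bigcup_k [set a | a \in S ++ F (e k)]).
    apply: bigcup_countable; first exact: countableP.
    by move=> k _; apply: finite_set_countable; exact: finite_seq.
  apply: sub_countable; apply: subset_card_le => a _.
  by have /existsNP[k /negP/negPn] := nex a; exists k.
have [k kP] : exists k, e k \notin S ++ G eta.
  apply: contrapT => /forallNP nex.
  (* Pigeonhole: a list cannot contain more distinct values of [e] than its length. *)
  have := @uniq_leq_size _ (map e (iota 0 (size (S ++ G eta)).+1)) (S ++ G eta).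
  rewrite map_inj_uniq ?iota_uniq // size_map size_iota ltnn => contra.
  suff: false by []; apply: contra => //.
  by move=> _ /mapP[k _ ->]; exact/negPn/negP/nex.
exists (e k), eta; move: kP (etaP k) (etaP 0); rewrite !mem_cat !negb_or.
by move=> /andP[? ?] /andP[? ?] _; split.
Qed.

End Omega1.

(** * The condensate *)

(* Join-semidistributivity fails at [jx], which equals [jx `|` (jy `&` jz)]. *)
Record join_sd_failure d (K : latticeType d) := JoinSDFailure {
  jo : K; jt : K; jx : K; jy : K; jz : K;
  jo_le : forall k, jo <= k;
  le_jt : forall k, k <= jt;
  jxy : jx `|` jy = jt;
  jxz : jx `|` jz = jt;
  jyz : jy `&` jz = jo;
  jx_neq : jx != jt }.

Section Retraction.
Context {W : eqType}.
Implicit Types (S : seq W) (u : option W).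

Definition retract S u : option W :=
  if u is Some a then if a \in S then u else None else None.

Lemma retract_sub S S' u :
  {subset S <= S'} -> retract S (retract S' u) = retract S u.
Proof.
move=> sub; case: u => //= a; case: ifP => [//|aS']; case: ifP => // /sub.
by rewrite aS'.
Qed.

Lemma retract_id S u : retract S (retract S u) = retract S u.
Proof. exact: retract_sub. Qed.

Lemma retract_notin S a : a \notin S -> retract S (Some a) = None.
Proof. by move=> /negbTE /= ->. Qed.

Lemma retract1_eq a u : (retract [:: a] u == Some a) = (u == Some a).
Proof.
by case: u => //= b; rewrite inE; case: ifP.
Qed.

End Retraction.

Section Condensate.
Context {d : Order.disp_t} {K : latticeType d} (F : join_sd_failure K).

Local Notation o := (jo F).
Local Notation t := (jt F).
Local Notation x := (jx F).
Local Notation y := (jy F).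
Local Notation z := (jz F).

Lemma jt_gt : o != t.
Proof.
apply/eqP=> ot; have := jx_neq F; rewrite eq_le le_jt /= -ot.
by rewrite jo_le.
Qed.

Definition D5_map (w : K) (e : D5) : K :=
  match e with
  | D5_0 => o | D5_a => x `&` w | D5_x => x | D5_y => w | D5_1 => t
  end.

Lemma D5_mapI w : {morph D5_map w : u v / u `&` v}.
Proof.
have o_l k : o `&` k = o by exact/meet_l/jo_le.
have o_r k : k `&` o = o by exact/meet_r/jo_le.
have t_l k : t `&` k = k by exact/meet_r/le_jt.
have t_r k : k `&` t = k by exact/meet_l/le_jt.
have x_r : x `&` w `&` x = x `&` w by exact/meet_l/leIl.
have x_l : x `&` (x `&` w) = x `&` w by exact/meet_r/leIl.
have w_r : x `&` w `&` w = x `&` w by exact/meet_l/leIr.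
have w_l : w `&` (x `&` w) = x `&` w by exact/meet_r/leIr.
by case; case; rewrite /= ?(o_l, o_r, t_l, t_r, x_l, x_r, w_l, w_r, meetxx) // meetC.
Qed.

(** The hypothesis serves for the join of [D5_x] with [D5_y]. *)
Lemma D5_mapU w : x `|` w = t -> {morph D5_map w : u v / u `|` v}.
Proof.
move=> xw; have wx : w `|` x = t by rewrite joinC.
have o_l k : o `|` k = k by exact/join_r/jo_le.
have o_r k : k `|` o = k by exact/join_l/jo_le.
have t_l k : t `|` k = t by exact/join_l/le_jt.
have t_r k : k `|` t = t by exact/join_r/le_jt.
have x_r : x `&` w `|` x = x by exact/join_r/leIl.
have x_l : x `|` x `&` w = x by exact/join_l/leIl.
have w_r : x `&` w `|` w = w by exact/join_r/leIr.
have w_l : w `|` x `&` w = w by exact/join_l/leIr.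
by case; case; rewrite /= ?(o_l, o_r, t_l, t_r, x_l, x_r, w_l, w_r, xw, wx, joinxx).
Qed.

Context {m : nat} {W : choiceType}.

(** With [m = n - 1], the chain has [m.+1] steps. The value jumps from [o] to [x] at level [i.+1]
    and from [x] to [t] at level [i.+2]. *)
Definition chain_map (i : 'I_m) (c : 'I_m.+2) : K :=
  if (c <= i)%N then o else if (c == i.+1 :> nat) then x else t.

Lemma chain_map_homo i c c' : c <= c' -> chain_map i c <= chain_map i c'.
Proof.
rewrite leEord /= /chain_map => cc'; case: ifP => [_|ci]; first exact: jo_le.
have [c'i|c'i] := leqP c' i; first by rewrite (leq_trans cc' c'i) in ci.
case: ifP => [/eqP hc|hc]; case: ifP => hc'; rewrite ?le_jt //.
by move: hc; rewrite eqn_leq -{1}(eqP hc') cc' ltnNge ci.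
Qed.

Lemma chain_mapI i : {morph chain_map i : c c' / c `&` c'}.
Proof.
move=> c c'; have [cc'|/ltW cc'] := leP c c'; have := chain_map_homo i cc'.
  by move=> /meet_l ->.
by move=> /meet_r ->.
Qed.

Lemma chain_mapU i : {morph chain_map i : c c' / c `|` c'}.
Proof.
move=> c c'; have [cc'|/ltW cc'] := leP c c'; have := chain_map_homo i cc'.
  by move=> /join_r ->.
by move=> /join_l ->.
Qed.

Lemma chain_map0 i : chain_map i ord0 = o.
Proof. by []. Qed.

Lemma chain_map_max i : chain_map i ord_max = t.
Proof.
rewrite /chain_map /=; case: ifP => [mi|_].
  by have := ltn_ord i; rewrite ltnNge (ltnW mi).
by rewrite eqSS; case: eqP => // mi; have := ltn_ord i; rewrite -mi ltnn.
Qed.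

Lemma chain_map_D5 w i c : exists e, chain_map i c = D5_map w e.
Proof.
by rewrite /chain_map; case: ifP; [exists D5_0|case: ifP; [exists D5_x|exists D5_1]].
Qed.

Definition supported (S : seq W) (f : 'I_m -> option W -> option W -> K) : Prop :=
  forall i u v, f i u v = f i (retract S u) (retract S v).

Lemma supported_sub S S' f : {subset S <= S'} -> supported S f -> supported S' f.
Proof.
by move=> sub fS i u v; rewrite fS [RHS]fS !(retract_sub _ sub).
Qed.

(* [None] is a point at infinity of [W]. The ranges of [D5_map y] and [D5_map z]
   are the distributive sublattices generated by [x, y] and by [x, z]. *)
Definition admissible (c : 'I_m.+2) (f : 'I_m -> option W -> option W -> K) : Prop :=
  [/\ forall i, f i None None = chain_map i c,
      forall i a, exists e, f i (Some a) None = D5_map y e,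
      forall i a, exists e, f i None (Some a) = D5_map z e
    & exists S, supported S f].

Definition grid (S : seq W) : seq ('I_m * (option W * option W)) :=
  [seq (i, uv) | i <- enum 'I_m,
     uv <- [seq (u, v) | u <- None :: map Some S, v <- None :: map Some S]].

(** A function with support [S] is thus determined by its values on the finite list [grid S]. *)
Lemma mem_grid S i u v : (i, (retract S u, retract S v)) \in grid S.
Proof.
have rS w : retract S w \in None :: map Some S.
  case: w => [a|]; rewrite ?mem_head //=; case: ifP => aS; rewrite ?mem_head //.
  by rewrite inE map_f.
by apply: allpairs_f; [rewrite mem_enum | exact: allpairs_f].
Qed.

Record condensate := Condensate {
  corner : 'I_m.+2;
  eval : 'I_m -> option W -> option W -> K;
  admissibleP : admissible corner eval }.

HB.instance Definition _ := gen_eqMixin condensate.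
HB.instance Definition _ := gen_choiceMixin condensate.

Lemma condensate_ext (f g : condensate) :
  corner f = corner g -> (forall i u v, eval f i u v = eval g i u v) -> f = g.
Proof.
case: f g => [c f fP] [c' g gP] /= cc' fg; rewrite -cc' in gP *.
have {}fg : f = g by do 3!apply: funext => ?; exact: fg.
by rewrite -fg in gP *; congr Condensate.
Qed.

Definition cond_le (f g : condensate) : bool :=
  (corner f <= corner g) && `[< forall i u v, eval f i u v <= eval g i u v >].

Fact cond_le_refl : reflexive cond_le.
Proof. by move=> f; apply/andP; split=> //; apply/asboolP. Qed.
Fact cond_le_anti : antisymmetric cond_le.
Proof.
move=> f g /andP[/andP[fg /asboolP fg'] /andP[gf /asboolP gf']].
apply: condensate_ext; first by apply: le_anti; rewrite fg gf.
by move=> i u v; apply: le_anti; rewrite fg' gf'.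
Qed.
Fact cond_le_trans : transitive cond_le.
Proof.
move=> g f h /andP[fg /asboolP fg'] /andP[gh /asboolP gh'].
apply/andP; split; first exact: le_trans gh.
by apply/asboolP => i u v; apply: le_trans (gh' i u v).
Qed.
HB.instance Definition _ := Order.Le_isPOrder.Build finlat_display condensate
  cond_le_refl cond_le_anti cond_le_trans.

Fact cond_meet_admissible (f g : condensate) :
  admissible (corner f `&` corner g) (fun i u v => eval f i u v `&` eval g i u v).
Proof.
case: f g => [c f [f1 f2 f3 [S fS]]] [c' g [g1 g2 g3 [S' gS]]] /=; split.
- by move=> i; rewrite f1 g1 chain_mapI.
- move=> i a; have [e ->] := f2 i a; have [e' ->] := g2 i a.
  by exists (e `&` e'); rewrite D5_mapI.
- move=> i a; have [e ->] := f3 i a; have [e' ->] := g3 i a.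
  by exists (e `&` e'); rewrite D5_mapI.
- exists (S ++ S') => i u v.
  by congr (_ `&` _);
    [apply: (supported_sub _ fS) | apply: (supported_sub _ gS)] => a;
    rewrite mem_cat => ->; rewrite ?orbT.
Qed.
Definition cond_meet f g := Condensate (cond_meet_admissible f g).

Fact cond_join_admissible (f g : condensate) :
  admissible (corner f `|` corner g) (fun i u v => eval f i u v `|` eval g i u v).
Proof.
case: f g => [c f [f1 f2 f3 [S fS]]] [c' g [g1 g2 g3 [S' gS]]] /=; split.
- by move=> i; rewrite f1 g1 chain_mapU.
- move=> i a; have [e ->] := f2 i a; have [e' ->] := g2 i a.
  by exists (e `|` e'); rewrite D5_mapU // jxy.
- move=> i a; have [e ->] := f3 i a; have [e' ->] := g3 i a.
  by exists (e `|` e'); rewrite D5_mapU // jxz.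
- exists (S ++ S') => i u v.
  by congr (_ `|` _);
    [apply: (supported_sub _ fS) | apply: (supported_sub _ gS)] => a;
    rewrite mem_cat => ->; rewrite ?orbT.
Qed.
Definition cond_join f g := Condensate (cond_join_admissible f g).

Fact cond_meetP f g h : (f <= cond_meet g h) = (f <= g) && (f <= h).
Proof.
apply/idP/idP.
  move=> /andP[]; rewrite /= lexI => /andP[fg fh] /asboolP le.
  apply/andP; split; apply/andP; split=> //; apply/asboolP => i u v;
    by have := le i u v; rewrite lexI => /andP[].
move=> /andP[/andP[fg /asboolP fg'] /andP[fh /asboolP fh']].
apply/andP; split; first by rewrite lexI fg fh.
by apply/asboolP => i u v; rewrite lexI fg' fh'.
Qed.
Fact cond_joinP f g h : (cond_join f g <= h) = (f <= h) && (g <= h).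
Proof.
apply/idP/idP.
  move=> /andP[]; rewrite /= leUx => /andP[fg fh] /asboolP le.
  apply/andP; split; apply/andP; split=> //; apply/asboolP => i u v;
    by have := le i u v; rewrite leUx => /andP[].
move=> /andP[/andP[fg /asboolP fg'] /andP[fh /asboolP fh']].
apply/andP; split; first by rewrite leUx fg fh.
by apply/asboolP => i u v; rewrite leUx fg' fh'.
Qed.
HB.instance Definition _ := Order.POrder_MeetJoin_isLattice.Build finlat_display
  condensate cond_meetP cond_joinP.

Fact chain_admissible (c : 'I_m.+2) : admissible c (fun i _ _ => chain_map i c).
Proof.
split=> // [i a|i a|]; [exact: chain_map_D5|exact: chain_map_D5|].
by exists [::].
Qed.
Definition chain_elt c := Condensate (chain_admissible c).

Fact cond_bottom f : chain_elt ord0 <= f.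
Proof.
apply/andP; split; first by rewrite /= leEord.
by apply/asboolP => i u v; exact: jo_le.
Qed.
Fact cond_top f : f <= chain_elt ord_max.
Proof.
apply/andP; split; first by rewrite /= leEord /= -ltnS.
by apply/asboolP => i u v; rewrite /= chain_map_max le_jt.
Qed.
HB.instance Definition _ :=
  Order.hasBottom.Build finlat_display condensate cond_bottom.
HB.instance Definition _ := Order.hasTop.Build finlat_display condensate cond_top.

Lemma condensate_leP (f g : condensate) :
  reflect (corner f <= corner g /\ forall i u v, eval f i u v <= eval g i u v)
    (f <= g).
Proof. by apply: (iffP andP) => -[fg fg']; split=> //; exact/asboolP. Qed.

Lemma cornerI : {morph corner : f g / f `&` g}. Proof. by []. Qed.
Lemma cornerU : {morph corner : f g / f `|` g}. Proof. by []. Qed.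
Lemma evalI i u v : {morph (fun f => eval f i u v) : f g / f `&` g}.
Proof. by []. Qed.
Lemma evalU i u v : {morph (fun f => eval f i u v) : f g / f `|` g}.
Proof. by []. Qed.

End Condensate.
Arguments condensate {d K} F m W.
Arguments grid m {W} S.

(** * Permutability of the condensate *)

(** [Q] is attached to the end of each step, so the start of the path enters through [h f = e p]. *)
Lemma steps_pullback (L P : Type) (e : P -> L) (h : L -> L) (Q : L -> Prop)
    (r r' : L -> L -> Prop) (m : nat) (f g : L) (p : P) :
  (forall w, Q w -> exists p, h w = e p) ->
  (forall u v, r u v -> r' (h u) (h v)) ->
  h f = e p -> steps (fun u v => Q v /\ r u v) m f g ->
  exists2 q, h g = e q & steps (fun a b => r' (e a) (e b)) m p q.
Proof.
move=> hQ rr'; elim: m f p => [|m IHm] f p hf /=; first by move=> <-; exists p.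
move=> [w [Qw fw] wg]; have [q hw] := hQ w Qw.
have [s hg qs] := IHm w q hw wg; exists s => //; exists q => //.
by rewrite -hf -hw; exact: rr'.
Qed.

Section CellLemma.
Context {dL dP : Order.disp_t} {L : latticeType dL} {P : latticeType dP}.
Variables (alpha beta : L -> L -> Prop) (e : P -> L) (delta : L) (Q : L -> Prop).
Hypotheses (ca : congruence alpha) (cb : congruence beta).
Hypothesis (eI : {morph e : p q / p `&` q}) (eU : {morph e : p q / p `|` q}).
Hypothesis QP : forall w, Q w -> exists p, w `&` delta = e p.

(** Meeting with [delta] moves the path into the image of [P]; the congruences are pulled back along
    [e], the path is shortened in [P], and the result is mapped back. *)
Lemma cell_alt_comp (k m : nat) (f g : L) :
  steppable (L := P) k -> Q f -> 
  steps (fun u v => Q v /\ either alpha beta u v) m f g ->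
  alt_comp k.+1 alpha beta (f `&` delta) (g `&` delta).
Proof.
move=> Pk /QP[p fp] fg.
have [|q gq pq] := steps_pullback (r' := either alpha beta) QP _ fp fg.
  by move=> u v [] uv; [left | right]; exact: congruence_meetl.
rewrite fp gq.
apply: (alt_comp_map (h := e) (r := fun a b => alpha (e a) (e b))
  (s := fun a b => beta (e a) (e b))) => //.
by apply: steppable_alt_comp => //; [exact: congruence_comap ..| exists m].
Qed.
End CellLemma.

Lemma alt_comp_partition d (L : tbLatticeType d) (alpha beta : L -> L -> Prop)
    (m : nat) (ds : seq L) (f g : L) :
  congruence alpha -> congruence beta ->
  f <= \join_(e <- ds) (f `&` e) -> g <= \join_(e <- ds) (g `&` e) ->
  (forall e, e \in ds -> alt_comp m alpha beta (f `&` e) (g `&` e)) ->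
  alt_comp m alpha beta f g.
Proof.
move=> ca cb fle gle fg.
have joinE h : h <= \join_(e <- ds) (h `&` e) -> h = \join_(e <- ds) (h `&` e).
  by move=> hle; apply: le_anti; rewrite hle; apply/joinsP_seq => e _ _; exact: leIl.
rewrite (joinE f fle) (joinE g gle) big_seq [X in alt_comp _ _ _ _ X]big_seq.
apply: big_ind2 => //.
  by apply: alt_comp_refl; exact: congruence_refl.
by move=> ? ? ? ? h1 h2; apply: alt_comp_map2 h1 h2; exact: congruence_join.
Qed.

Section CondensatePermutable.
Context {d : Order.disp_t} {K : latticeType d} (F : join_sd_failure K).
Context {m : nat} {W : choiceType}.
Local Notation L := (condensate F m W).
Local Notation o := (jo F).
Local Notation t := (jt F).

(** A cell element has corner [ord0], so at the corner at infinity only [o] is possible. *)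
Definition edge_value (u v : option W) (k : K) : Prop :=
  match u, v with
  | Some _, Some _ => True
  | Some _, None => exists e, k = D5_map F (jy F) e
  | None, Some _ => exists e, k = D5_map F (jz F) e
  | None, None => k = o
  end.

Lemma cell_admissible (S : seq W) (i0 : 'I_m) (u0 v0 : option W) (k : K) :
  edge_value u0 v0 k ->
  admissible F ord0 (fun i u v =>
    if [&& i == i0, retract S u == u0 & retract S v == v0] then k else o).
Proof.
move=> kP; split.
- move=> i; rewrite chain_map0; case: ifP => // /and3P[_ /eqP u0E /eqP v0E].
  by move: kP; rewrite -u0E -v0E.
- move=> i a; case: ifP => [/and3P[_ _ /eqP v0E]|_]; last by exists D5_0.
  by move: kP; rewrite -v0E; case: u0 => [b|->] //=; exists D5_0.
- move=> i a; case: ifP => [/and3P[_ /eqP u0E _]|_]; last by exists D5_0.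
  by move: kP; rewrite -u0E; case: v0 => [b|->] //=; exists D5_0.
- by exists S => i u v; rewrite !retract_id.
Qed.

Definition cell S i0 u0 v0 k (kP : edge_value u0 v0 k) : L :=
  Condensate (cell_admissible S i0 kP).

(** The value [o] at the corner is a filler that keeps [cell_top] admissible; [corner_elt] covers
    that cell. *)
Lemma cell_top_edge u0 v0 :
  edge_value u0 v0 (if (u0 == None) && (v0 == None) then o else t).
Proof. by case: u0 v0 => [a|] [b|] //; exists D5_1. Qed.

Definition cell_top S i0 u0 v0 : L := cell S i0 (cell_top_edge u0 v0).

Lemma cellE S i0 u0 v0 k (kP : edge_value u0 v0 k) (w : L) :
  supported S (eval w) -> (u0, v0) != (None, None) -> eval w i0 u0 v0 = k ->
  w `&` cell_top S i0 u0 v0 = cell S i0 kP.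
Proof.
move=> wS uv wk; apply: condensate_ext.
  by rewrite cornerI /=; apply/meet_r; rewrite leEord.
move=> i u v; rewrite evalI /=; case: ifP => [/and3P[/eqP -> /eqP hu /eqP hv]|_].
  rewrite wS hu hv wk ifN; first exact/meet_l/le_jt.
  by move: uv; rewrite xpair_eqE.
exact/meet_r/jo_le.
Qed.

(** All [m] functions share one cell at the corner, since there a single point of the chain
    determines them all. *)
Lemma corner_admissible (S : seq W) (c : 'I_m.+2) :
  admissible F c (fun i u v =>
    if (retract S u == None) && (retract S v == None) then chain_map F i c else o).
Proof.
split=> [i|i a|i a|] //.
- by case: ifP => _; [exact: chain_map_D5 | exists D5_0].
- by case: ifP => _; [exact: chain_map_D5 | exists D5_0].
- by exists S => i u v; rewrite !retract_id.
Qed.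

Definition corner_elt S c : L := Condensate (corner_admissible S c).

Lemma corner_eltI S : {morph corner_elt S : c c' / c `&` c'}.
Proof.
move=> c c'; apply: condensate_ext => // i u v; rewrite evalI /=.
by case: ifP => _; rewrite ?chain_mapI ?meetxx.
Qed.

Lemma corner_eltU S : {morph corner_elt S : c c' / c `|` c'}.
Proof.
move=> c c'; apply: condensate_ext => // i u v; rewrite evalU /=.
by case: ifP => _; rewrite ?chain_mapU ?joinxx.
Qed.

Lemma corner_eltE S (w : L) :
  supported S (eval w) -> w `&` corner_elt S ord_max = corner_elt S (corner w).
Proof.
move=> wS; apply: condensate_ext.
  by rewrite cornerI /=; apply/meet_l; rewrite leEord /= -ltnS.
move=> i u v; rewrite evalI /=; case: ifP => [/andP[/eqP hu /eqP hv]|_].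
  rewrite wS hu hv; have [-> _ _ _] := admissibleP w.
  by rewrite chain_map_max; exact/meet_l/le_jt.
exact/meet_r/jo_le.
Qed.

Section CellMorphism.
Context {dP : Order.disp_t} {P : latticeType dP} (phi : P -> K).
Variables (S : seq W) (i0 : 'I_m) (u0 v0 : option W).
Hypothesis phiP : forall p, edge_value u0 v0 (phi p).

Lemma cell_morphI : {morph phi : p q / p `&` q} ->
  {morph (fun p => cell S i0 (phiP p)) : p q / p `&` q}.
Proof.
move=> phiI p q; apply: condensate_ext => [|i u v].
  by rewrite cornerI /= meetxx.
by rewrite evalI /=; case: ifP => _; rewrite ?phiI ?meetxx.
Qed.

Lemma cell_morphU : {morph phi : p q / p `|` q} ->
  {morph (fun p => cell S i0 (phiP p)) : p q / p `|` q}.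
Proof.
move=> phiU p q; apply: condensate_ext => [|i u v].
  by rewrite cornerU /= joinxx.
by rewrite evalU /=; case: ifP => _; rewrite ?phiU ?joinxx.
Qed.
End CellMorphism.

Lemma steps_supported (r : L -> L -> Prop) (k : nat) (f g : L) :
  steps r k f g -> exists S, supported S (eval f) /\
    steps (fun u v => supported S (eval v) /\ r u v) k f g.
Proof.
have supp (w : L) : exists S, supported S (eval w) by case: (admissibleP w).
elim: k f => [|k IHk] f /=; first by move=> <-; have [S fS] := supp f; exists S.
move=> [w fw /IHk[S [wS wg]]]; have [S' fS'] := supp f; exists (S' ++ S).
have sub : {subset S <= S' ++ S} by move=> a aS; rewrite mem_cat aS orbT.
split.
  by apply: supported_sub fS' => a aS; rewrite mem_cat aS.
exists w; first by split=> //; exact: supported_sub wS.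
apply: (steps_map (h := id)) wg => u v [vS uv]; split=> //.
exact: supported_sub vS.
Qed.

Definition cells (S : seq W) : seq L :=
  corner_elt S ord_max :: [seq cell_top S p.1 p.2.1 p.2.2 | p <- grid m S].

(** Each argument lies in the cell of its retraction, where some member of the list takes the value
    [t]; the corner coordinate is covered by [corner_elt]. *)
Lemma cells_cover S (f : L) : f <= \join_(e <- cells S) (f `&` e).
Proof.
have sup e : e \in cells S -> f `&` e <= \join_(e <- cells S) (f `&` e).
  by move=> eS; exact: (@joins_sup_seq _ _ _ _ xpredT (fun e => f `&` e)) eS isT.
have /sup/condensate_leP[cle ele] : corner_elt S ord_max \in cells S.
  exact: mem_head.
apply/condensate_leP; split.
  apply: le_trans cle; rewrite cornerI lexI lexx leEord /=.
  by rewrite -ltnS.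
move=> i u v.
have [/andP[hu hv]|huv] := boolP ((retract S u == None) && (retract S v == None)).
  apply: le_trans (ele i u v); rewrite evalI /= hu hv chain_map_max.
  by rewrite lexI lexx le_jt.
have /sup/condensate_leP[_ le] :
    cell_top S i (retract S u) (retract S v) \in cells S.
  rewrite inE; apply/orP; right.
  by apply/mapP; exists (i, (retract S u, retract S v)); rewrite ?mem_grid.
apply: le_trans (le i u v); rewrite evalI /= !eqxx /= (negbTE huv).
by rewrite lexI lexx le_jt.
Qed.

Local Arguments alt_comp : simpl never.

Theorem condensate_permutable :
  (0 < m)%N -> steppable (L := K) 2 -> congruence_permutable m.+2 L.
Proof.
move=> m0 Kst.
suff main (alpha beta : L -> L -> Prop) f g : congruence alpha -> congruence beta ->
    alt_comp m.+2 beta alpha f g -> alt_comp m.+2 alpha beta f g.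
  by move=> alpha beta ca cb f g; split; exact: main.
move=> ca cb ab; have fg0 := alt_comp_steps ab.
have [S [fS fg]] : exists S, supported S (eval f) /\
    steps (fun u v => supported S (eval v) /\ either alpha beta u v) m.+2 f g.
  apply: steps_supported.
  by apply: (steps_map (h := id)) fg0 => u v []; [right | left].
apply: (alt_comp_partition ca cb (cells_cover S f) (cells_cover S g)) => c.
(* The corner cell is a chain with [m.+1] steps, which accounts exactly for the [m.+2] factors. *)
rewrite inE => /orP[/eqP ->|/mapP[[i [u v]] _ ->] /=].
  apply: (cell_alt_comp (e := corner_elt S) (Q := fun w => supported S (eval w)))
    fS fg => //; [exact: corner_eltI | exact: corner_eltU | | exact: ord_steppable].
  by move=> w wS; exists (corner w); exact: corner_eltE.
(* Here [0 < m] gives [2 <= m.+1], so the remaining cells fit as well. *)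
have st2 : steppable (L := K) m.+1 by apply: steppable_weaken Kst.
have D5st : steppable (L := D5) m.+1 by apply: steppable_weaken D5_steppable.
case: u v => [a|] [b|].
- have kP k : edge_value (Some a) (Some b) k by [].
  apply: (cell_alt_comp (e := fun k => cell S i (kP k))
    (Q := fun w => supported S (eval w))) fS fg => //.
  + exact: (cell_morphI (phi := id)).
  + exact: (cell_morphU (phi := id)).
  + by move=> w wS; exists (eval w i (Some a) (Some b)); exact: cellE.
- have eP e : edge_value (Some a) None (D5_map F (jy F) e) by exists e.
  apply: (cell_alt_comp (e := fun e => cell S i (eP e))
    (Q := fun w => supported S (eval w))) fS fg => //.
  + exact/cell_morphI/D5_mapI.
  + exact/cell_morphU/D5_mapU/jxy.
  + move=> w wS; have [_ /(_ i a)[e we] _ _] := admissibleP w.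
    by exists e; exact: cellE.
- have eP e : edge_value None (Some b) (D5_map F (jz F) e) by exists e.
  apply: (cell_alt_comp (e := fun e => cell S i (eP e))
    (Q := fun w => supported S (eval w))) fS fg => //.
  + exact/cell_morphI/D5_mapI.
  + exact/cell_morphU/D5_mapU/jxz.
  + move=> w wS; have [_ _ /(_ i b)[e we] _] := admissibleP w.
    by exists e; exact: cellE.
- have bot w : w `&` cell_top S i None None = \bot.
    apply/eqP; rewrite -lex0; apply/condensate_leP; split.
      by rewrite cornerI /= leIr.
    by move=> j u v; rewrite evalI /= if_same leIr.
  by rewrite !bot; apply: alt_comp_refl; exact: congruence_refl.
Qed.

End CondensatePermutable.

(** * Congruence-preserving extensions *)

Section Extension.
Context {dA dB : Order.disp_t} {A : latticeType dA} {B : latticeType dB}.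
Variable f : A -> B.
Hypotheses (fI : {morph f : a b / a `&` b}) (fU : {morph f : a b / a `|` b}).
Hypothesis cpe : forall theta : A -> A -> Prop, congruence theta ->
  (exists psi, congruence_extends f theta psi) /\
  (forall psi psi', congruence_extends f theta psi ->
     congruence_extends f theta psi' -> forall x y, psi x y <-> psi' x y).

(** The intersection of all extensions is a congruence for every [theta]; by uniqueness it is the
    extension whenever [theta] is a congruence. *)
Definition ext (theta : A -> A -> Prop) (u v : B) : Prop :=
  forall psi, congruence_extends f theta psi -> psi u v.

Lemma ext_congruence theta : congruence (ext theta).
Proof. by apply: congruence_inter => psi []. Qed.

Lemma extP theta : congruence theta -> congruence_extends f theta (ext theta).
Proof.
move=> /cpe[[psi ext_psi] _]; split; first exact: ext_congruence.
move=> a b; split; first by move/(_ psi ext_psi); case: ext_psi => _ ->.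
by move=> ab psi' [_ ->].
Qed.

Lemma extE theta a b : congruence theta -> ext theta (f a) (f b) <-> theta a b.
Proof. by move=> /extP[_]. Qed.

(** The intersection of the two extensions still extends [theta], hence is its extension by
    uniqueness. *)
Lemma ext_mono (theta theta' : A -> A -> Prop) u v :
  congruence theta -> congruence theta' ->
  (forall a b, theta a b -> theta' a b) -> ext theta u v -> ext theta' u v.
Proof.
move=> ct ct' sub.
pose both (b : bool) := if b then theta else theta'.
pose psi u v := forall b, True -> ext (both b) u v.
have cpsi : congruence psi by apply: congruence_inter => b _; exact: ext_congruence.
have psi_ext : congruence_extends f theta psi.
  split=> // a b; split=> [/(_ true I) /=|ab [] _ /=]; rewrite extE //.
  exact: sub.
have [_ uniq] := cpe ct.
by move=> /(uniq _ _ (extP ct) psi_ext) /(_ false I).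
Qed.

(* Compact congruences: the principal congruence of [B] generated by [(u, v)] is
   the directed union of the congruences generated by its finite sets of pairs
   from [A]. *)
Lemma ext_finite_support (u v : B) : exists G : seq (A * A),
  forall theta, congruence theta ->
  (ext theta u v <-> forall p, p \in G -> theta p.1 p.2).
Proof.
pose Theta := cg_gen (fun a b => a = u /\ b = v).
have cTheta : congruence Theta := cg_gen_congruence _.
pose in_seq (G : seq (A * A)) a b := exists2 p, p \in G & a = f p.1 /\ b = f p.2.
pose Phi a b := exists G : seq (A * A),
  (forall p, p \in G -> Theta (f p.1) (f p.2)) /\ cg_gen (in_seq G) a b.
have gen_sub (G G' : seq (A * A)) a b : {subset G <= G'} ->
    cg_gen (in_seq G) a b -> cg_gen (in_seq G') a b.
  move=> sub ab theta [ct Gt]; apply: ab; split=> // a' b' [p pG ab'].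
  by apply: Gt; exists p => //; exact: sub.
have PhiU (op : B -> B -> B) a a' b b' :
    (forall theta a a' b b', congruence theta -> theta a a' -> theta b b' ->
      theta (op a b) (op a' b')) ->
    Phi a a' -> Phi b b' -> Phi (op a b) (op a' b').
  move=> opP [G [GT aa']] [G' [GT' bb']]; exists (G ++ G'); split.
    by move=> p; rewrite mem_cat => /orP[/GT|/GT'].
  apply: (opP (cg_gen (in_seq (G ++ G')))); first exact: cg_gen_congruence.
    by apply: gen_sub aa' => p pG; rewrite mem_cat pG.
  by apply: gen_sub bb' => p pG; rewrite mem_cat pG orbT.
have cPhi : congruence Phi.
  split.
  - move=> a; exists [::]; split=> //; apply: congruence_refl.
    exact: cg_gen_congruence.
  - move=> a b [G [GT ab]]; exists G; split=> //; apply: congruence_sym ab.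
    exact: cg_gen_congruence.
  - move=> a b c [G [GT ab]] [G' [GT' bc]]; exists (G ++ G'); split.
      by move=> p; rewrite mem_cat => /orP[/GT|/GT'].
    apply: (congruence_trans (cg_gen_congruence _) (y := b)).
      by apply: gen_sub ab => p pG; rewrite mem_cat pG.
    by apply: gen_sub bc => p pG; rewrite mem_cat pG orbT.
  - move=> a a' b b'; apply: PhiU => theta ? ? ? ? ct; exact: congruence_meet.
  - move=> a a' b b'; apply: PhiU => theta ? ? ? ? ct; exact: congruence_join.
have [_ uniq] := cpe (congruence_comap fI fU cTheta).
(* [Phi] and [Theta] restrict to the same congruence of [A], as a pair of [A] collapsed by [Theta]
   forms a one-element list; uniqueness makes them equal. *)
have [G [GT uvG]] : Phi u v.
  suff -> : Phi u v <-> Theta u v by move=> theta [_]; exact.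
  apply: uniq; split=> // a b; split=> [[G [GT ab]]|ab].
    by apply: ab; split=> // _ _ [p pG [-> ->]]; exact: GT.
  exists [:: (a, b)]; split; first by move=> p; rewrite inE => /eqP ->.
  by move=> theta [_]; apply; exists (a, b); rewrite ?mem_head.
exists G => theta ct; split=> [uv p /GT pT|GP].
  rewrite -extE //; apply: pT; split; first exact: ext_congruence.
  by move=> _ _ [-> ->].
apply: uvG; split; first exact: ext_congruence.
by move=> _ _ [p pG [-> ->]]; rewrite extE //; exact: GP.
Qed.

End Extension.

(** * Extensions of the condensate *)

Section CondensateExtension.
Context {dK : Order.disp_t} {K : latticeType dK} (F : join_sd_failure K).
Context {m : nat} {W : choiceType}.
Local Notation L := (condensate F m W).
Local Notation o := (jo F).
Local Notation t := (jt F).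
Local Notation x := (jx F).
Local Notation y := (jy F).
Local Notation z := (jz F).

(** Being below [y] on the row [a] is tested against this element. It is constant along the row, so
    the tests at infinity and at an interior point concern the same pair of elements of [B]. *)
Lemma edge_y_admissible (a : W) :
  admissible F ord_max
    (fun (i : 'I_m) (u v : option W) => if u == Some a then y else t).
Proof.
split=> [i|i b|i b|]; rewrite ?chain_map_max //.
- by case: eqP => _; [exists D5_y | exists D5_1].
- by exists D5_1.
- by exists [:: a] => i u v; rewrite retract1_eq.
Qed.
Definition edge_y a : L := Condensate (edge_y_admissible a).

Lemma edge_z_admissible (a : W) :
  admissible F ord_max
    (fun (i : 'I_m) (u v : option W) => if v == Some a then z else t).
Proof.
split=> [i|i b|i b|]; rewrite ?chain_map_max //.
- by exists D5_1.
- by case: eqP => _; [exists D5_y | exists D5_1].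
- by exists [:: a] => i u v; rewrite retract1_eq.
Qed.
Definition edge_z a : L := Condensate (edge_z_admissible a).

Definition eval_eq i u v (a b : L) : Prop := eval a i u v = eval b i u v.

Lemma eval_eq_congruence i u v : congruence (eval_eq i u v).
Proof.
exact: (congruence_comap (evalI i u v) (evalU i u v) (congruence_eq (L := K))).
Qed.

(** Kernel of a homomorphism into the two-element chain, which cuts the chain of corners just below
    [k]. *)
Definition level (k : nat) (a b : L) : Prop := (k <= corner a)%N = (k <= corner b)%N.

Lemma level_congruence k : congruence (level k).
Proof.
have levelI (c c' : 'I_m.+2) : (k <= (c `&` c')%O)%N = (k <= c)%N && (k <= c')%N.
  have [|/ltW] := leP c c'; rewrite leEord /= => cc'; apply/idP/andP => [kc|[]//].
    by split=> //; exact: leq_trans cc'.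
  by split=> //; exact: leq_trans cc'.
have levelU (c c' : 'I_m.+2) : (k <= (c `|` c')%O)%N = (k <= c)%N || (k <= c')%N.
  have [|/ltW] := leP c c'; rewrite leEord /= => cc'; apply/idP/orP => [->|[]//];
    try by [left | right].
    by move=> kc; exact: leq_trans cc'.
  by move=> kc; exact: leq_trans cc'.
rewrite /level; split=> //.
- by move=> ? ? ? -> ->.
- by move=> a a' b b' ha hb; rewrite !cornerI !levelI ha hb.
- by move=> a a' b b' ha hb; rewrite !cornerU !levelU ha hb.
Qed.

Section Edge.
Variables (s : K) (i : 'I_m) (u v : option W).
Hypothesis xs : x `|` s = t.
Hypothesis evalD5 : forall w : L, exists e, eval w i u v = D5_map F s e.

Definition below_x (a b : L) : Prop := eval a i u v `&` x = eval b i u v `&` x.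
Definition above_x (a b : L) : Prop := eval a i u v `|` x = eval b i u v `|` x.

Let mapI := D5_mapI F s.
Let mapU := D5_mapU xs.

(** Joins are respected because meeting with [x] distributes over joins in [D5], hence on the
    edge. *)
Lemma below_x_congruence : congruence below_x.
Proof.
have xE : x = D5_map F s D5_x by [].
rewrite /below_x; split=> //.
- by move=> ? ? ? -> ->.
- move=> a a' b b'; rewrite !evalI => ha hb.
  by rewrite -[x]meetxx meetACA ha hb meetACA.
- move=> a a' b b'; rewrite !evalU.
  have [e ->] := evalD5 a; have [e' ->] := evalD5 a'.
  have [g ->] := evalD5 b; have [g' ->] := evalD5 b'.
  rewrite xE -!mapU -!mapI ![(_ `|` _) `&` _]meetC !D5_meetUr !mapU.
  by rewrite ![D5_x `&` _]meetC => -> ->.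
Qed.

Lemma above_x_congruence : congruence above_x.
Proof.
have xE : x = D5_map F s D5_x by [].
rewrite /above_x; split=> //.
- by move=> ? ? ? -> ->.
- move=> a a' b b'; rewrite !evalI.
  have [e ->] := evalD5 a; have [e' ->] := evalD5 a'.
  have [g ->] := evalD5 b; have [g' ->] := evalD5 b'.
  have joinIr (p q : D5) : (p `&` q) `|` D5_x = (p `|` D5_x) `&` (q `|` D5_x).
    by case: p; case: q.
  by rewrite xE -!mapI -!mapU !joinIr !mapI => -> ->.
- move=> a a' b b'; rewrite !evalU => ha hb.
  by rewrite -[x]joinxx joinACA ha hb joinACA.
Qed.

(** In a distributive lattice an element is determined by its meet and its join with [x]. *)
Lemma below_above_x a b : below_x a b -> above_x a b -> eval_eq i u v a b.
Proof.
have xE : x = D5_map F s D5_x by [].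
rewrite /below_x /above_x /eval_eq; have [e ->] := evalD5 a; have [g ->] := evalD5 b.
rewrite xE -!mapI -!mapU => hI hU.
have -> : D5_map F s e = D5_map F s (e `&` g) `|` D5_map F s (e `&` D5_x).
  by rewrite -mapU -D5_meetUr mapI -hU -mapI joinKI.
by rewrite hI -mapU meetC -D5_meetUr mapI hU -mapI joinKI.
Qed.
End Edge.

Lemma common_support (G : seq (L * L)) : exists S, forall p, p \in G ->
  supported S (eval p.1) /\ supported S (eval p.2).
Proof.
elim: G => [|[a b] G [S SP]]; first by exists [::].
have [_ _ _ [S1 aS1]] := admissibleP a; have [_ _ _ [S2 bS2]] := admissibleP b.
exists (S1 ++ S2 ++ S) => p; rewrite inE => /orP[/eqP -> /=|/SP[h1 h2]]; split.
- by apply: supported_sub aS1 => c cS; rewrite mem_cat cS.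
- by apply: supported_sub bS2 => c cS; rewrite !mem_cat cS orbT.
- by apply: supported_sub h1 => c cS; rewrite !mem_cat cS !orbT.
- by apply: supported_sub h2 => c cS; rewrite !mem_cat cS !orbT.
Qed.

Lemma chain_map_le (i : 'I_m) (c c' : 'I_m.+2) :
  (i.+1 <= c)%N = (i.+1 <= c')%N -> chain_map F i c `&` x = chain_map F i c' `&` x.
Proof.
have above (e : 'I_m.+2) : chain_map F i e `&` x = if (i.+1 <= e)%N then x else o.
  rewrite /chain_map ltnNge; case: leqP => _ /=; first exact/meet_l/jo_le.
  by case: eqP => _; rewrite ?meetxx //; exact/meet_r/le_jt.
by rewrite !above => ->.
Qed.

(** The value [t] is reached exactly from [i.+2] on, because [o] and [x] both differ from [t]. *)
Lemma chain_map_lt (i : 'I_m) (c c' : 'I_m.+2) :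
  chain_map F i c = chain_map F i c' -> (i.+2 <= c)%N = (i.+2 <= c')%N.
Proof.
have top (e : 'I_m.+2) : (i.+2 <= e)%N = (chain_map F i e == t).
  rewrite /chain_map; have [ei|ei] := leqP e i.
    by rewrite (negbTE (jt_gt F)) ltnNge leqW.
  rewrite ltn_neqAle ei andbT eq_sym; case: eqP => _; rewrite ?eqxx //.
  by rewrite (negbTE (jx_neq F)).
by rewrite !top => ->.
Qed.

Context {dB : Order.disp_t} {B : latticeType dB} (f : L -> B).
Hypotheses (fI : {morph f : a b / a `&` b}) (fU : {morph f : a b / a `|` b}).
Hypothesis cpe : forall theta : L -> L -> Prop, congruence theta ->
  (exists psi, congruence_extends f theta psi) /\
  (forall psi psi', congruence_extends f theta psi ->
     congruence_extends f theta psi' -> forall x y, psi x y <-> psi' x y).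

Lemma ext_supported (u v : B) : exists GS : seq (L * L) * seq W,
  (forall theta, congruence theta ->
    (ext f theta u v <-> forall p, p \in GS.1 -> theta p.1 p.2)) /\
  (forall p, p \in GS.1 -> supported GS.2 (eval p.1) /\ supported GS.2 (eval p.2)).
Proof.
have [G GP] := ext_finite_support fI fU cpe u v; have [S SP] := common_support G.
by exists (G, S).
Qed.

(* On an edge the evaluations form a distributive lattice, where the congruences
   collapsing [o, x] and [x, t] have trivial intersection. *)
Lemma ext_edge (s : K) (i : 'I_m) (u v : option W) (w : B) (a : L) :
  x `|` s = t -> (forall b : L, exists e, eval b i u v = D5_map F s e) ->
  eval a i u v `|` x = t -> f \bot <= w -> w <= f \top ->
  ext f (below_x i u v) w (f \bot) -> ext f (eval_eq i u v) (w `&` f a) w.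
Proof.
move=> xs evalD5 ax w0 w1 wbot.
have cb := below_x_congruence xs evalD5; have ca := above_x_congruence xs evalD5.
have eb := ext_congruence f (below_x i u v).
have ea := ext_congruence f (above_x i u v).
(* Above [x] the element [a] acts as the top; below [x], in [bb], both sides are bottom. *)
have ab : ext f (above_x i u v) (w `&` f a) w.
  rewrite -[X in ext _ _ _ X](meet_l w1) ![w `&` _]meetC.
  apply: (congruence_meetl w ea); apply/(extE cpe) => //.
  by rewrite /above_x ax /= chain_map_max; apply/esym/join_l/le_jt.
have bb : ext f (below_x i u v) (w `&` f a) w.
  apply: (congruence_trans eb (y := f \bot)).
    have := congruence_meetl (f a) eb wbot; rewrite -fI.
    by rewrite (meet_l (le0x _)).
  exact: (congruence_sym eb).
have [[G S] [GP _]] := ext_supported (w `&` f a) w.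
apply/GP; first exact: eval_eq_congruence.
move=> p pG; apply: (below_above_x xs evalD5).
  by have /GP := bb; apply.
by have /GP := ab; apply.
Qed.

(* Step [j] of a path that uses the two congruences in the wrong order leaves
   level [k] unchanged unless [j] and [k] have the same parity.  Hence if the
   levels left the bottom one after the other, level [k] would do so only at step
   [k], which is too late for the last one. *)
Lemma permutable_level : congruence_permutable m.+1 B ->
  exists w (i : 'I_m), [/\ f \bot <= w, w <= f \top,
    ext f (level i.+1) w (f \bot) & ~ ext f (level i.+2) w (f \bot)].
Proof.
move=> perm.
pose parity (b : bool) (a a' : L) := forall k, odd k = b -> level k a a'.
have cparity b : congruence (parity b).
  by apply: congruence_inter => k _; exact: level_congruence.
pose c j : L := chain_elt F (inord j).
have c0 : c 0 = \bot.
  by rewrite /c; congr chain_elt; apply: val_inj; rewrite /= inordK.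
have c1 : c m.+1 = \top.
  by rewrite /c; congr chain_elt; apply: val_inj; rewrite /= inordK.
(* Step [j] of the chain changes level [j.+1] only, whose parity differs from that of [j]. *)
have cpath : alt_comp m.+1 (parity false) (parity true) \bot \top.
  rewrite -c0 -c1; apply: alt_comp_path => j jm.
  suff : parity (odd j) (c j) (c j.+1) by case: odd.
  move=> k kj; rewrite /level /= !inordK ?ltnS //; last exact: ltnW.
  rewrite [RHS]leq_eqVlt ltnS; case: eqP => // kE.
  by move: kj; rewrite kE /=; case: odd.
have fpath :
    alt_comp m.+1 (ext f (parity false)) (ext f (parity true)) (f \bot) (f \top).
  by apply: alt_comp_map cpath => a a' aa'; apply/(extE cpe).
have [cf ct] := (ext_congruence f (parity false), ext_congruence f (parity true)).
have [w [w0 wm wS]] := alt_compP ((perm _ _ cf ct _ _).1 fpath).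
have f01 : f \bot <= f \top by rewrite leEmeet -fI (meet_l (le0x _)).
pose v j := clamp (f \bot) (f \top) (w j).
have v0 : v 0 = f \bot by rewrite /v w0 clampl.
have vm : v m.+1 = f \top by rewrite /v wm clampr.
have vS j k : (j <= m)%N -> odd k != odd j -> ext f (level k) (v j) (v j.+1).
  move=> jm kj; apply: (congruence_clamp _ _ (ext_congruence f (level k))).
  have : ext f (parity (~~ odd j)) (w j) (w j.+1) by have := wS j jm; case: odd.
  apply: (ext_mono cpe) => //; first exact: level_congruence.
  by move=> a a'; apply; move: kj; case: odd; case: odd.
apply: contrapT => none.
(* If [v j] left the bottom at level [i.+2] but not at level [i.+1], it would be the required
   [w]. *)
have down (i : 'I_m) j : ~ ext f (level i.+2) (v j) (f \bot) ->
    ~ ext f (level i.+1) (v j) (f \bot).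
  move=> n2 n1; apply: none; exists (v j), i; split=> //.
    by rewrite lexI leUr f01.
  exact: leIr.
have late j k : (j <= m.+1)%N -> (0 < k <= m.+1)%N ->
    ~ ext f (level k) (v j) (f \bot) -> (k < j)%N.
  elim: j k => [|j IHj] k jm km nk.
    by case: nk; rewrite v0; apply: congruence_refl; exact: ext_congruence.
  have back l : odd l != odd j -> (0 < l <= m.+1)%N ->
      ~ ext f (level l) (v j.+1) (f \bot) -> (l < j)%N.
    move=> lj lm nl; apply: IHj => //; first exact: ltnW.
    have cl := ext_congruence f (level l); move=> h; apply: nl.
    by apply: (congruence_trans cl) h; apply: (congruence_sym cl); exact: vS.
  have [kj|kj] := eqVneq (odd k) (odd j); last by apply: ltnW; exact: back.
  (* For level 1, [j] is odd, hence nonzero. For a higher level, the level just below has been left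
     as well, and step [j] cannot change that one. *)
  case: k km nk kj => [|[|k]] //= km nk kj; first by case: j kj {IHj back jm nk}.
  rewrite ltnS; apply: (back k.+1); rewrite /= -?kj; first by case: odd.
    exact: ltnW.
  have kP : (k < m)%N by [].
  exact: (down (Ordinal kP)).
have := late m.+1 m.+1 (leqnn _); rewrite !leqnn ltnn => /(_ isT) last.
suff: false by []; apply: last; rewrite vm => /(extE cpe); rewrite /level /= leqnn.
by move/(_ (level_congruence _)).
Qed.

Theorem no_permutable_extension :
  ~ countable [set: W]%classic -> ~ congruence_permutable m.+1 B.
Proof.
move=> Wunc perm.
have [w [i [w0 w1 wi wi1]]] := permutable_level perm.
have [GS GSP] := choice (fun uv : B * B => ext_supported uv.1 uv.2).
pose supp u v := (GS (u, v)).2.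
have [G0P G0S] := GSP (w, f \bot).
(* Both points avoid the support of the pair of [w] and bottom, so the place they determine behaves
   like the corner. Each also avoids the support of the inequality attached to the other, so both
   inequalities can be moved to the interior. *)
have [xi [eta [xi0 eta0 etaF xiG]]] := free_pair (supp w (f \bot))
  (fun a => supp (w `&` f (edge_y a)) w) (fun a => supp (w `&` f (edge_z a)) w) Wunc.
have eval_corner (a : L) u v : supported (supp w (f \bot)) (eval a) ->
    retract (supp w (f \bot)) u = None -> retract (supp w (f \bot)) v = None ->
    eval a i u v = chain_map F i (corner a).
  by move=> aS hu hv; rewrite aS hu hv; have [-> _ _ _] := admissibleP a.
have xiN := retract_notin xi0; have etaN := retract_notin eta0.
have below u v (s : K) : x `|` s = t ->
    (forall b : L, exists e, eval b i u v = D5_map F s e) ->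
    retract (supp w (f \bot)) u = None -> retract (supp w (f \bot)) v = None ->
    ext f (below_x i u v) w (f \bot).
  move=> xs evalD5 hu hv; apply/G0P; first exact: below_x_congruence evalD5.
  move=> p pG; have [p1S p2S] := G0S p pG.
  rewrite /below_x !eval_corner //; apply: chain_map_le.
  by have /G0P := wi; apply => //; exact: level_congruence.
have evalY (b : L) : exists e, eval b i (Some xi) None = D5_map F y e.
  by have [_ h _ _] := admissibleP b.
have evalZ (b : L) : exists e, eval b i None (Some eta) = D5_map F z e.
  by have [_ _ h _] := admissibleP b.
have wY : ext f (eval_eq i (Some xi) None) (w `&` f (edge_y xi)) w.
  apply: (ext_edge (jxy F)) => //; last exact: (below _ _ _ (jxy F)).
  by rewrite /= eqxx joinC jxy.
have wZ : ext f (eval_eq i None (Some eta)) (w `&` f (edge_z eta)) w.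
  apply: (ext_edge (jxz F)) => //; last exact: (below _ _ _ (jxz F)).
  by rewrite /= eqxx joinC jxz.
have cE := ext_congruence f (eval_eq i (Some xi) (Some eta)).
(* Since [eta] avoids the support of the generating pairs, evaluating them at [eta] is the same as
   at infinity. *)
have wY' : ext f (eval_eq i (Some xi) (Some eta)) (w `&` f (edge_y xi)) w.
  have [GP GS1] := GSP (w `&` f (edge_y xi), w).
  apply/GP; first exact: eval_eq_congruence.
  move=> p pG; have [p1S p2S] := GS1 p pG; rewrite /eval_eq.
  have hE (a : L) : supported (GS (w `&` f (edge_y xi), w)).2 (eval a) ->
      eval a i (Some xi) (Some eta) = eval a i (Some xi) None.
    by move=> aS; rewrite aS (retract_notin etaF) [RHS]aS.
  rewrite !hE //; have /GP := wY; apply => //; exact: eval_eq_congruence.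
have wZ' : ext f (eval_eq i (Some xi) (Some eta)) (w `&` f (edge_z eta)) w.
  have [GP GS1] := GSP (w `&` f (edge_z eta), w).
  apply/GP; first exact: eval_eq_congruence.
  move=> p pG; have [p1S p2S] := GS1 p pG; rewrite /eval_eq.
  have hE (a : L) : supported (GS (w `&` f (edge_z eta), w)).2 (eval a) ->
      eval a i (Some xi) (Some eta) = eval a i None (Some eta).
    by move=> aS; rewrite aS (retract_notin xiG) [RHS]aS.
  rewrite !hE //; have /GP := wZ; apply => //; exact: eval_eq_congruence.
(* Modulo this congruence [w] equals its meet with both edge elements, whose common value at this
   point is the meet of [y] and [z], that is [o]. *)
have wbot : ext f (eval_eq i (Some xi) (Some eta)) w (f \bot).
  apply: (congruence_trans cE (congruence_sym cE wZ')).
  apply: (congruence_trans cE (y := w `&` f (edge_y xi) `&` f (edge_z eta))).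
    by apply: (congruence_meetl _ cE); exact: (congruence_sym cE).
  rewrite -meetA -fI -[X in ext _ _ _ X](meet_r w0).
  apply: (congruence_meet cE); first exact: (congruence_refl cE).
  apply/(extE cpe); first exact: eval_eq_congruence.
  by rewrite /eval_eq evalI /= !eqxx jyz.
(* The interior point now acts as the corner, where equal values of [chain_map] force agreement at
   level [i.+2]. *)
apply: wi1; apply/G0P; first exact: level_congruence.
move=> p pG; have [p1S p2S] := G0S p pG; apply: chain_map_lt.
rewrite -(eval_corner p.1 (Some xi) (Some eta)) //.
rewrite -(eval_corner p.2 (Some xi) (Some eta)) //.
by have /G0P := wbot; apply => //; exact: eval_eq_congruence.
Qed.

End CondensateExtension.

(** * Cardinality, varieties and duality *)

Section CondensateCardinal.
Context {d : Order.disp_t} {K : latticeType d} (F : join_sd_failure K).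
Context {m : nat} {W : choiceType} (lt : W -> W -> Prop).
Hypotheses (ltW : omega1_order lt) (Wunc : ~ countable [set: W]%classic).
Local Notation L := (condensate F m W).

(** The elements [edge_y a] are distinct, since [y = t] would give [z = o] and then [x = t]. *)
Lemma condensate_uncountable : (0 < m)%N -> ~ countable [set: L]%classic.
Proof.
move=> m0 Lcount; apply: Wunc.
apply: (countable_inj (f := @edge_y _ _ F m W)) Lcount => a b.
move/(congr1 (fun f : L => eval f (Ordinal m0) (Some a) None)) => /=.
rewrite eqxx; case: eqP => [[]//|_ yt].
have := jx_neq F; have := jyz F; rewrite yt (meet_r (le_jt F _)) => zo.
by have := jxz F; rewrite zo (join_l (jo_le F _)) => ->; rewrite eqxx.
Qed.

(** An element is coded by a bound of its support together with natural numbers: the images of the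
    support under an injection of the segment below the bound, the corner, and the values on the
    grid. *)
Lemma condensate_code : countable [set: K]%classic ->
  exists h : L -> W * nat, injective h.
Proof.
move=> /countable_injP[kc kcinj].
have seg (a : W) : exists c : W -> nat,
      forall b b', lt b a -> lt b' a -> c b = c b' -> b = b'.
  have /countable_injP[c cinj] := omega1_segment ltW a.
  by exists c => b b' ba b'a; apply: cinj; rewrite inE.
have [c cP] := choice seg.
have data (f : L) : exists aS : W * seq W,
    supported aS.2 (eval f) /\ forall s, s \in aS.2 -> lt s aS.1.
  have [_ _ _ [S fS]] := admissibleP f.
  by have [a aP] := omega1_bound S ltW Wunc; exists (a, S).
have [D DP] := choice data.
pose table (f : L) S := [seq kc (eval f p.1 p.2.1 p.2.2) | p <- grid m S].
pose h (f : L) : W * nat := ((D f).1, pickle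
  (map (c (D f).1) (D f).2, corner f : nat, table f (D f).2)).
exists h => f g; rewrite /h => -[].
have [fS fa] := DP f; have [gS ga] := DP g.
move=> aE /(pcan_inj pickleK)[]; rewrite -aE in ga *.
move=> SE cE tE.
have {}SE : (D f).2 = (D g).2.
  elim: (D f).2 (D g).2 fa ga SE {fS gS tE}
    => [|s S IHS] [|s' S'] //= fa ga [ss' SS'].
  have -> : s = s' by apply: cP ss'; [apply: fa | apply: ga]; exact: mem_head.
  by congr (_ :: _); apply: IHS SS' => b bS; [apply: fa | apply: ga];
    rewrite inE bS orbT.
rewrite -SE in gS tE; apply: condensate_ext => [|i u v]; first exact: val_inj.
rewrite fS gS; move/eq_in_map: tE => /(_ _ (mem_grid _ i u v)) /=.
by apply: kcinj; rewrite inE.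
Qed.

Lemma condensate_aleph1 :
  (0 < m)%N -> countable [set: K]%classic -> card_aleph1 L.
Proof.
move=> m0 /condensate_code[h hinj]; split; first exact: condensate_uncountable.
by move=> U; exact: omega1_card_le ltW hinj.
Qed.
End CondensateCardinal.

Lemma lattice_eval_morph d (L : latticeType d) d' (K : latticeType d') (h : L -> K)
    (v : nat -> L) (s : lattice_term) :
  {morph h : a b / a `&` b} -> {morph h : a b / a `|` b} ->
  h (lattice_eval v s) = lattice_eval (h \o v) s.
Proof.
by move=> hI hU; elim: s => //= s IHs u IHu; rewrite ?hI ?hU IHs IHu.
Qed.

(** The evaluations are homomorphisms to [K], and the corners are separated by homomorphisms into
    the sublattice of [o] and [t], so the identities of [K] pass to the condensate. *)
Lemma condensate_models E d (K : latticeType d) (F : join_sd_failure K) m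
    (W : choiceType) :
  lattice_models E K -> lattice_models E (condensate F m W).
Proof.
move=> KE s u su v; apply: condensate_ext => [|i a b]; last first.
  rewrite (lattice_eval_morph _ _ (evalI i a b) (evalU i a b)).
  by rewrite (lattice_eval_morph _ _ (evalI i a b) (evalU i a b)) (KE s u su).
pose h k (f : condensate F m W) := if (k <= corner f)%O then jt F else jo F.
have hI k : {morph h k : f g / f `&` g}.
  move=> f g; rewrite /h cornerI lexI; case: leP => _ /=.
    by rewrite (meet_r (le_jt _ _)).
  by rewrite (meet_l (jo_le _ _)).
have hU k : {morph h k : f g / f `|` g}.
  move=> f g; rewrite /h cornerU lexU; case: leP => _ /=.
    by rewrite (join_l (le_jt _ _)).
  by rewrite (join_r (jo_le _ _)).
have hE k : h k (lattice_eval v s) = h k (lattice_eval v u).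
  by rewrite !(lattice_eval_morph _ _ (hI k) (hU k)) (KE s u su).
have tE k f : (k <= corner f)%O = (h k f == jt F).
  by rewrite /h; case: ifP; rewrite ?eqxx ?(negbTE (jt_gt F)).
apply: le_anti; rewrite tE -hE -tE lexx /=.
by rewrite tE hE -tE lexx.
Qed.

Definition condensate_conclusion (n : nat) (V : lattice_class) :=
  exists (d : Order.disp_t) (L : tbLatticeType d),
    V d L /\ congruence_permutable n.+1 L /\ card_aleph1 L /\
    ~ (exists (d' : Order.disp_t) (B : latticeType d') (f : {lmorphism L -> B}),
         congruence_preserving_extension f /\ congruence_permutable n B).

Lemma join_sd_failure_conclusion n V d (K : finLatticeType d) :
  (2 <= n)%N -> lattice_variety V -> V d K -> join_sd_failure K ->
  steppable (L := K) 2 -> condensate_conclusion n V.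
Proof.
move=> n2 [E VE] VK F Kst.
have [W [lt [ltW Wunc]]] := exists_omega1.
case: n n2 => [//|m] m0.
exists finlat_display, (condensate F m W : tbLatticeType _).
split; [|split; [|split]].
- by apply/VE/condensate_models/VE.
- exact: condensate_permutable.
- by apply: (condensate_aleph1 F ltW Wunc) => //; exact: countableP.
- move=> [d' [B [f [[_ cpe] perm]]]].
  exact: (no_permutable_extension (omorphI f) (omorphU f) cpe Wunc perm).
Qed.

(** * Passage to dual lattices *)

Fixpoint dual_term (s : lattice_term) : lattice_term :=
  match s with
  | LVar i => LVar i
  | LMeet s u => LJoin (dual_term s) (dual_term u)
  | LJoin s u => LMeet (dual_term s) (dual_term u)
  end.

Lemma dual_termK : involutive dual_term.
Proof. by elim=> //= s -> u ->. Qed.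

Lemma lattice_eval_dual d (L : latticeType d) (v : nat -> L) (s : lattice_term) :
  lattice_eval (L := L^d) v (dual_term s) = lattice_eval v s.
Proof. by elim: s => //= s -> u ->. Qed.

Definition dual_class (V : lattice_class) : lattice_class :=
  fun d L => V (Order.dual_display d) (L^d)%type.

Lemma dual_variety V : lattice_variety V -> lattice_variety (dual_class V).
Proof.
move=> [E VE]; exists [set p | E (dual_term p.1, dual_term p.2)]%classic => d L.
rewrite /dual_class VE; split=> [LE s u su v|LE s u su v].
  rewrite -(lattice_eval_dual v s) -(lattice_eval_dual v u); exact: LE.
have := LE (dual_term s) (dual_term u); rewrite /= !dual_termK => /(_ su v).
rewrite -(@lattice_eval_dual d L v (dual_term s)).
rewrite -(@lattice_eval_dual d L v (dual_term u)).
by rewrite !dual_termK.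
Qed.

Lemma congruence_dual d (L : latticeType d) (theta : L -> L -> Prop) :
  congruence (L := L^d) theta <-> congruence theta.
Proof. by split=> -[? ? ? ? ?]; split. Qed.

Lemma congruence_permutable_dual n d (L : latticeType d) :
  congruence_permutable n (L^d)%type <-> congruence_permutable n L.
Proof.
by split=> perm alpha beta ca cb; apply: perm; apply/congruence_dual.
Qed.

Section DualMorphism.
Context {d d' : Order.disp_t} {L : latticeType d} {B : latticeType d'}.
Variable f : {lmorphism (L^d)%type -> B}.

Definition dual_fun : L -> (B^d)%type := f.

Fact dual_funI : {morph dual_fun : a b / a `&` b}.
Proof. by move=> a b; exact: (omorphU f). Qed.
Fact dual_funU : {morph dual_fun : a b / a `|` b}.
Proof. by move=> a b; exact: (omorphI f). Qed.
Fact dual_fun_homo : {homo dual_fun : a b / a <= b}.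
Proof. by move=> a b /meet_l ab; apply/meet_idPl; rewrite -dual_funI ab. Qed.

HB.instance Definition _ := Order.isOrderMorphism.Build d L
  (Order.dual_display d') (B^d)%type dual_fun dual_fun_homo.
HB.instance Definition _ := Order.isLatticeMorphism.Build d L
  (Order.dual_display d') (B^d)%type dual_fun dual_funI dual_funU.
End DualMorphism.

(** A lattice and its dual have the same carrier and the same congruences, so an extension of one
    becomes, after reversal, an extension of the other. *)
Lemma dual_conclusion n V :
  condensate_conclusion n (dual_class V) -> condensate_conclusion n V.
Proof.
move=> [d [L [VL [perm [cardL noext]]]]].
exists (Order.dual_display d), (L^d)%type; split; [|split; [|split]] => //.
- exact/congruence_permutable_dual.
- move=> [d' [B [f [[finj cpe] permB]]]]; apply: noext.
  exists (Order.dual_display d'), (B^d)%type, (dual_fun f : {lmorphism L -> B^d}).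
  split; last first.
    exact/congruence_permutable_dual.
  split=> // theta /congruence_dual/cpe[[psi [cpsi psiE]] uniq]; split.
    by exists psi; split=> //; exact/congruence_dual.
  move=> psi1 psi2 [/congruence_dual c1 e1] [/congruence_dual c2 e2].
  by apply: uniq.
Qed.

Lemma M3_failure : join_sd_failure M3.
Proof.
by apply: (@JoinSDFailure _ M3 M3_0 M3_1 M3_x1 M3_x2 M3_x3) => //;
  case; rewrite leEmeet; vm_compute.
Qed.
Lemma L2_failure : join_sd_failure L2.
Proof.
by apply: (@JoinSDFailure _ L2 L2_0 L2_1 L2_x3 L2_x1 L2_x2) => //;
  case; rewrite leEmeet; vm_compute.
Qed.
Lemma L3_failure : join_sd_failure L3.
Proof.
by apply: (@JoinSDFailure _ L3 L3_0 L3_1 L3_x3 L3_x1 L3_x2) => //;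
  case; rewrite leEmeet; vm_compute.
Qed.
Lemma L4_failure : join_sd_failure L4.
Proof.
by apply: (@JoinSDFailure _ L4 L4_0 L4_1 L4_x3 L4_x1 L4_x2) => //;
  case; rewrite leEmeet; vm_compute.
Qed.

Theorem theorem10p7 (n : nat) (hn : (2 <= n)%N)
    (V : lattice_class) (hV : lattice_variety V)
    (hK : V _ M3 \/ V _ L2 \/ V _ L3 \/ V _ L4 \/
          V _ (L2^d)%type \/ V _ (L4^d)%type) :
  exists (d : Order.disp_t) (L : tbLatticeType d),
    V d L /\ congruence_permutable n.+1 L /\ card_aleph1 L /\
    ~ (exists (d' : Order.disp_t) (B : latticeType d') (f : {lmorphism L -> B}),
         congruence_preserving_extension f /\ congruence_permutable n B).
Proof.
have hVd := dual_variety hV.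
case: hK => [VK|[VK|[VK|[VK|[VK|VK]]]]].
- exact: (join_sd_failure_conclusion hn hV VK M3_failure M3_steppable).
- exact: (join_sd_failure_conclusion hn hV VK L2_failure L2_steppable).
- exact: (join_sd_failure_conclusion hn hV VK L3_failure L3_steppable).
- exact: (join_sd_failure_conclusion hn hV VK L4_failure L4_steppable).
- apply: dual_conclusion.
  exact: (join_sd_failure_conclusion hn hVd (VK : dual_class V L2)
    L2_failure L2_steppable).
- apply: dual_conclusion.
  exact: (join_sd_failure_conclusion hn hVd (VK : dual_class V L4)
    L4_failure L4_steppable).
Qed.
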